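(* Let the source $f$ be the one given on the Fourier side by $\widehat f(z,\omega,u(z,\omega))=\frac12e^{-k(\omega)}\widehat u(z,\omega)$ for $(z,\omega)\in[0,1]\times[0,+\infty)$ and $\widehat f(z,\omega,u(z,\omega))=0$ for $(z,\omega)\in[0,1]\times(-\infty,0)$. Then the corresponding integral problem is unstable (the solution does not depend continuously on the data): for any $(g,h)\in L^2(\mathbb{R})\times L^2(\mathbb{R})$ with corresponding solution $u(g,h)\in C([0,1];L^2(\mathbb{R}))$, there exist $(g_n,h_n)\in L^2(\mathbb{R})\times L^2(\mathbb{R})$, $n\ge1$, with corresponding solutions $u(g_n,h_n)\in C([0,1];L^2(\mathbb{R}))$, such that $$\|g_n-g\|_{L^2(\mathbb{R})}+\|h_n-h\|_{L^2(\mathbb{R})}\to0\quad(n\to\infty),$$ while $\sup_{0\le x\le1}\|u(g_n,h_n)(x,\cdot)-u(g,h)(x,\cdot)\|_{L^2(\mathbb{R})}$ does not converge to $0$ as $n\to\infty$.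
   Context: Fix $0<\alpha<1$. Here $L^2(\mathbb{R})$ consists of complex-valued functions of $t\in\mathbb{R}$, with Fourier transform $\widehat v(\omega)=\frac{1}{\sqrt{2\pi}}\int_{-\infty}^{\infty}v(t)e^{-i\omega t}\,dt$; for a function $u$ on $[0,1]\times\mathbb{R}$, $\widehat u(x,\omega)$ is the Fourier transform of $u(x,\cdot)$. Put $$k(\omega)=(i\omega)^{\alpha/2}=|\omega|^{\alpha/2}\Big(\cos\tfrac{\alpha\pi}{4}+i\,\mathrm{sign}(\omega)\sin\tfrac{\alpha\pi}{4}\Big),$$ and interpret $\sinh(k(\omega)y)/k(\omega)$ as $y$ at $\omega=0$. A solution corresponding to $(g,h)$ is a function $u\in C([0,1];L^2(\mathbb{R}))$ such that for $0\le x\le 1$ and a.e. $\omega\in\mathbb{R}$ $$\widehat u(x,\omega)=\cosh(k(\omega)x)\,\widehat g(\omega)+\frac{\sinh(k(\omega)x)}{k(\omega)}\,\widehat h(\omega)-\int_0^x\frac{\sinh(k(\omega)(x-z))}{k(\omega)}\,\widehat f(z,\omega,u(z,\omega))\,dz ,$$ where $\widehat f(z,\omega,u(z,\omega))$ is the Fourier transform in $t$ of the source term $f(z,t,u(z,t))$. *)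

(* Defs.v *)
From mathcomp Require Import all_boot all_order all_algebra.
From mathcomp Require Import complex.
From mathcomp Require Import all_classical all_reals all_analysis.
Import Order.TTheory GRing.Theory Num.Theory.
Import numFieldNormedType.Exports.

Set Implicit Arguments.
Unset Strict Implicit.
Unset Printing Implicit Defensive.

Local Open Scope classical_set_scope.
Local Open Scope ring_scope.
Local Open Scope complex_scope.

Section ComplexFunctions.
Context {R : realType}.
Implicit Types (z : R[i]) (D : set R) (f : R -> R[i]).

Definition cexp z : R[i] :=
  (expR (complex.Re z) * cos (complex.Im z))
    +i* (expR (complex.Re z) * sin (complex.Im z)).

Definition ccosh z : R[i] := (cexp z + cexp (- z)) / 2%:R.

Definition csinh z : R[i] := (cexp z - cexp (- z)) / 2%:R.

Definition cmeasurable_fun d (T : measurableType d) (D : set T)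
    (f : T -> R[i]) : Prop :=
  measurable_fun D (fun x => complex.Re (f x)) /\
  measurable_fun D (fun x => complex.Im (f x)).

Definition cintegrable D f : Prop :=
  lebesgue_measure.-integrable D (fun x => (complex.Re (f x))%:E) /\
  lebesgue_measure.-integrable D (fun x => (complex.Im (f x))%:E).

Definition cintegral D f : R[i] :=
  (\int[lebesgue_measure]_(x in D) complex.Re (f x))
    +i* (\int[lebesgue_measure]_(x in D) complex.Im (f x)).

End ComplexFunctions.

(* Elements of L^2(R) are handled through (Borel measurable) representatives,
   and equality in L^2(R) is equality almost everywhere. *)
Section L2.
Context {R : realType}.
Implicit Types (f v w : R -> R[i]) (u : R -> R -> R[i]).

Definition L2norm f : \bar R :=
  Lnorm lebesgue_measure 2%:E (fun t => (ComplexField.Normc.normc (f t))%:E).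

Definition in_L2 f : Prop := cmeasurable_fun setT f /\ (L2norm f < +oo)%E.

Definition continuous_L2 u : Prop :=
  (forall x : R, x \in `[0, 1] -> in_L2 (u x)) /\
  (forall x : R, x \in `[0, 1] ->
    L2norm (u y \- u x) @[y --> within `[0, 1]%classic (nbhs x)] --> 0%E).

Definition truncated_fourier (n : nat) v (w : R) : R[i] :=
  (Num.sqrt (2 * pi))^-1%:C *
  cintegral `[- n%:R, n%:R]%classic (fun t => v t * cexp (0 +i* - (w * t))).

(* For v in L^2(R) the integral defining the Fourier transform need not
   converge absolutely: the transform is the limit in L^2(R) of the transforms
   of the truncations of v to [-n, n].  The relation says that vhat represents
   the resulting class. *)
Definition is_fourier v (vhat : R -> R[i]) : Prop :=
  [/\ in_L2 v, in_L2 vhat &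
      L2norm (vhat \- truncated_fourier n v) @[n --> \oo] --> 0%E].

End L2.

Section IntegralProblem.
Context {R : realType}.
Variable alpha : R.

(* The principal value of (i w)^(alpha/2). *)
Definition ksymb (w : R) : R[i] :=
  (`|w| `^ (alpha / 2))%:C *
  (cos (alpha * pi / 4) +i* (Num.sg w * sin (alpha * pi / 4))).

Definition sinh_over_k (w y : R) : R[i] :=
  if w == 0 then y%:C else csinh (ksymb w * y%:C) / ksymb w.

(* The source is an operator sending z and the function t |-> u(z,t) to the
   function t |-> f(z,t,u(z,t)); a source prescribed by a Fourier multiplier is
   not a pointwise function of the value u(z,t). *)
Implicit Types (f : R -> (R -> R[i]) -> (R -> R[i])).

(* For each z the Fourier transform F z of the source is defined only up to a
   null set depending on z, so the integral in z at a fixed frequency makes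
   sense through a jointly measurable choice of representatives. *)
Definition solution f (g h : R -> R[i]) (u : R -> R -> R[i]) : Prop :=
  continuous_L2 u /\
  exists (ghat hhat : R -> R[i]) (U F : R -> R -> R[i]),
    [/\ is_fourier g ghat, is_fourier h hhat,
        forall z : R, z \in `[0, 1] ->
          is_fourier (u z) (U z) /\ is_fourier (f z (u z)) (F z),
        cmeasurable_fun (`[(0 : R), 1]%classic `*` [set: R])
          (fun p : R * R => F p.1 p.2) &
        forall x : R, x \in `[0, 1] ->
          {ae lebesgue_measure, forall w : R,
            cintegrable `[0, x]%classic
              (fun z => sinh_over_k w (x - z) * F z w) /\
            U x w = ccosh (ksymb w * x%:C) * ghat w
              + sinh_over_k w x * hhat w
              - cintegral `[0, x]%classic
                  (fun z => sinh_over_k w (x - z) * F z w)}].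

Definition source_multiplier (w : R) : R[i] :=
  if 0 <= w then 2%:R^-1 * cexp (- ksymb w) else 0.

Definition is_given_source f : Prop :=
  forall (z : R) (v vhat : R -> R[i]), z \in `[0, 1] ->
    is_fourier v vhat ->
    is_fourier (f z v) (fun w => source_multiplier w * vhat w).

End IntegralProblem.

(* Main.v *)
(* On the Fourier side, for w > 0, the integral equation is U'' = (k^2 - s) U with
   k = ksymb alpha w and s = cexp (- k) / 2.  Let m be the square root of k^2 - s
   with nonnegative real part; since alpha < 1, Re m grows like |w|^(alpha/2).
   Perturb the data so that the transform of the solution changes by
   cexp (m (x - 1)) on a band [a, a + 1] and by 0 elsewhere.  At x = 1 this
   perturbation has norm 1, while the data perturbations cexp (- m) and
   m cexp (- m) tend to 0 as a goes to infinity.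

   Passing from these transforms back to functions of t requires Plancherel's
   theorem for bounded functions supported in [a, b] and continuous off {a, b}.
   It follows from Abel summation: the weight exp (- e |t|) turns the energy of
   the transform into a Poisson average.  The inversion formula is then a
   consequence of Plancherel's identity applied to the truncations of the inverse
   transform. *)
Require Import Defs.
From mathcomp Require Import all_boot all_order all_algebra.
From mathcomp Require Import complex ring lra.
From mathcomp Require Import all_classical all_reals all_analysis measurable_realfun.
Import Order.TTheory GRing.Theory Num.Theory.
Import numFieldNormedType.Exports.

Local Open Scope classical_set_scope.
Local Open Scope ring_scope.
Local Open Scope complex_scope.

Set Implicit Arguments.
Unset Strict Implicit.
Unset Printing Implicit Defensive.

(** The perturbation solves the integral equation exactly, source term included, which is why its
    exponent is [m] rather than [k]. The problem being linear, it can be added to an arbitrary given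
    solution, and all estimates concern explicit exponentials. For 0 < alpha < 1 the argument alpha
    pi / 2 of k^2 lies strictly between 0 and pi / 2, so both coordinates of k^2 are positive and
    grow like |w|^alpha, while those of s stay at most 1/2. The real part forces the growth of Re m;
    the imaginary part keeps k^2 - s in the upper half-plane, where an explicit formula gives a
    square root continuous in w. The difficulty lies in the transform: perturbations are prescribed
    at the frequencies, whereas [is_fourier] starts from a function of t and asks for L2 convergence
    of truncated transforms. A band function jumps at its end points, so its inverse transform is in
    general not integrable, and inversion cannot be an absolutely convergent integral. The
    convergence is read off instead from an exact formula for the energy of the truncation error. *)

Section Kernels.
Context {R : realType}.
Local Notation mu := (@lebesgue_measure R).

Lemma ge0_integral_oppr (f : R -> R) : measurable_fun setT f ->
  (forall t, 0 <= f t) ->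
  (\int[mu]_t (f (- t))%:E = \int[mu]_t (f t)%:E)%E.
Proof.
move=> mf f0.
have -> : [set: R] = (-%R : _ -> measurableTypeR R) @^-1` setT.
  by rewrite preimage_setT.
rewrite -(@ge0_integral_pushforward _ _ _ (measurableTypeR R) R _ _ _ _ (EFin \o f))//=.
- apply: eq_measure_integral => //= A mA _; exact: lebesgue_measureN.
- by apply/measurable_EFinP.
- by move=> t _; rewrite lee_fin.
Qed.

Lemma continuous_abel (e : R) : continuous (fun t : R => expR (- (e * `|t|))).
Proof.
move=> t; apply: continuous_comp; last exact: continuous_expR.
apply: cvgN; apply: cvgMl_tmp; exact: norm_continuous.
Qed.

Lemma continuous_cosM (s : R) : continuous (fun t : R => cos (s * t)).
Proof.
move=> t; apply: continuous_comp; last exact: continuous_cos.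
by apply: cvgMl_tmp; exact: cvg_id.
Qed.

Lemma continuous_sinM (s : R) : continuous (fun t : R => sin (s * t)).
Proof.
move=> t; apply: continuous_comp; last exact: continuous_sin.
by apply: cvgMl_tmp; exact: cvg_id.
Qed.

(* Adding 1 to the cosine makes the integrand nonnegative, as required by the
   improper form of the fundamental theorem of calculus. *)
Lemma integral_abel_onePcos (e s : R) : 0 < e ->
  (\int[mu]_t (expR (- (e * `|t|)) * (1 + cos (s * t)))%:E =
   (2 / e + 2 * e / (e ^+ 2 + s ^+ 2))%:E)%E.
Proof.
move=> e0.
have es0 : e ^+ 2 + s ^+ 2 != 0.
  by rewrite gt_eqF// ltr_wpDr ?sqr_ge0// exprn_gt0.
have cf : continuous (fun t : R => expR (- (e * `|t|)) * (1 + cos (s * t))).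
  move=> t; apply: cvgM; first exact: continuous_abel.
  by apply: cvgD; [exact: cvg_cst|exact: continuous_cosM].
have f0 (t : R) : 0 <= expR (- (e * `|t|)) * (1 + cos (s * t)).
  by rewrite mulr_ge0 ?expR_ge0// -lerBlDl sub0r cos_geN1.
rewrite ge0_symfun_integralT//; last first.
  by move=> t /=; rewrite normrN mulrN cosN.
rewrite -set_itvcy.
(* An antiderivative on t >= 0 that vanishes at infinity. The half-line integral is thus - F 0, and
   evenness doubles it. *)
pose F t := expR (- (e * t)) *
  (- e^-1 + (s * sin (s * t) - e * cos (s * t)) / (e ^+ 2 + s ^+ 2)).
have dF (t : R) : is_derive t (1 : R) F (expR (- (e * t)) * (1 + cos (s * t))).
  rewrite /F; apply: is_derive_eq.
  rewrite /GRing.scale /= !mulr1 ?mul0r ?addr0 ?add0r ?mulr0.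
  by field; rewrite es0 lt0r_neq0.
rewrite (@ge0_continuous_FTC2y R
  (fun t => expR (- (e * `|t|)) * (1 + cos (s * t))) F 0 0).
- rewrite /F !mulr0 oppr0 expR0 sin0 cos0 mulr0 -EFinB -EFinM; congr EFin.
  by field; rewrite es0 lt0r_neq0.
- by move=> t _.
- exact: continuous_subspaceT.
- pose C := e^-1 + (`|s| + e) / (e ^+ 2 + s ^+ 2).
  apply/norm_cvg0P.
  apply: (@squeeze_cvgr _ _ _ _ (cst 0) (fun t => expR (- (e * t)) * C)).
  + near=> t; rewrite normr_ge0/= normrM ger0_norm ?expR_ge0//.
    rewrite ler_pM2l ?expR_gt0//.
    rewrite (le_trans (ler_normD _ _))// normrN ger0_norm ?invr_ge0 ?(ltW e0)//.
    rewrite /C lerD2l normrM [X in _ * X <= _]ger0_norm; last first.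
      by rewrite invr_ge0 addr_ge0// sqr_ge0.
    rewrite ler_wpM2r ?invr_ge0 ?addr_ge0 ?sqr_ge0//.
    rewrite (le_trans (ler_normB _ _))// !normrM (gtr0_norm e0).
    rewrite lerD// ler_piMr//; first by rewrite ler_norml sin_geN1 sin_le1.
      exact: ltW.
    by rewrite ler_norml cos_geN1 cos_le1.
  + exact: cvg_cst.
  + rewrite -(mul0r C); apply: cvgMr_tmp.
    apply: (@cvg_comp _ _ _ (fun t => e * t) (fun t => expR (- t)) _ +oo%R).
      exact: gt0_cvgMry.
    exact: cvgr_expR.
- by move=> t _; exact: ex_derive.
- apply: cvg_at_right_filter.
  by apply: differentiable_continuous; apply/derivable1_diffP; exact: ex_derive.
- move=> t; rewrite in_itv/= andbT => t0.
  by rewrite derive1E derive_val gtr0_norm.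
Unshelve. all: by end_near. Qed.

Lemma integrableM_bounded (D : set R) (f K : R -> R) (C : R) :
  measurable D -> mu.-integrable D (EFin \o f) -> measurable_fun D K ->
  (forall x, D x -> `|K x| <= C) ->
  mu.-integrable D (EFin \o (fun x => f x * K x)).
Proof.
move=> mD fi mK KC.
apply: (@le_integrable _ _ _ mu D mD _ (EFin \o (fun x => C * f x))).
- apply/measurable_EFinP; apply: measurable_funM => //.
  by apply/measurable_EFinP; exact: measurable_int fi.
- move=> x Dx /=; rewrite !lee_fin normrM [leRHS]normrM mulrC ler_wpM2r//.
  by rewrite (le_trans (KC _ Dx))// ler_norm.
- by rewrite /comp; under eq_fun do rewrite EFinM; exact: integrableZl.
Qed.

Lemma integrable_abel (e : R) : 0 < e ->
  mu.-integrable setT (EFin \o (fun t : R => expR (- (e * `|t|)))).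
Proof.
move=> e0; apply/integrableP; split.
  apply/measurable_EFinP; apply: continuous_measurable_fun. exact: continuous_abel.
(* At s = 0 the factor 1 + cos equals 2, so this finite integral dominates that of the weight. *)
have := integral_abel_onePcos 0 e0; move: (_ / _ + _) => r H.
apply: (@le_lt_trans _ _ r%:E); last exact: ltry.
rewrite -H; apply: ge0_le_integral => //=.
- by apply/measurable_EFinP/measurableT_comp => //;
    apply: continuous_measurable_fun; exact: continuous_abel.
- apply/measurable_EFinP; apply: measurable_funM.
    by apply: continuous_measurable_fun; exact: continuous_abel.
  apply: measurable_funD => //.
  by apply: continuous_measurable_fun; exact: continuous_cosM.
- move=> t _; rewrite lee_fin ger0_norm ?expR_ge0// mul0r cos0.
  by rewrite ler_peMr ?expR_ge0// lerDl.
Qed.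

Lemma integral_abel_cos (e s : R) : 0 < e ->
  \int[mu]_t (expR (- (e * `|t|)) * cos (s * t)) = 2 * e / (e ^+ 2 + s ^+ 2).
Proof.
move=> e0.
have ia := integrable_abel e0.
have iac r : mu.-integrable setT
    (EFin \o (fun t : R => expR (- (e * `|t|)) * cos (r * t))).
  apply: (@integrableM_bounded _ _ _ 1) => //.
    by apply: continuous_measurable_fun; exact: continuous_cosM.
  by move=> t _; rewrite ler_norml cos_geN1 cos_le1.
have split r : \int[mu]_t (expR (- (e * `|t|)) * (1 + cos (r * t))) =
    \int[mu]_t expR (- (e * `|t|)) +
    \int[mu]_t (expR (- (e * `|t|)) * cos (r * t)).
  rewrite -RintegralD//; apply: eq_Rintegral => t _.
  by rewrite mulrDr mulr1.
(* Taking r = 0 in [split] makes both summands equal to this integral, while the left side is 4 /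
   e. *)
have ea : \int[mu]_t expR (- (e * `|t|)) = 2 / e.
  have := split 0; rewrite /Rintegral integral_abel_onePcos//=.
  under [in X in _ = _ + X -> _]eq_integral do rewrite mul0r cos0 mulr1.
  move: (fine _) => z.
  have -> : 2 * e / (e ^+ 2 + 0 ^+ 2) = 2 / e by field; rewrite lt0r_neq0.
  by lra.
have := split s; rewrite ea /Rintegral integral_abel_onePcos//=.
by move=> /addrI.
Qed.

Lemma integralT_oneDsqrV :
  (\int[mu]_x ((oneDsqr x)^-1)%:E = pi%:E)%E.
Proof.
rewrite ge0_symfun_integralT; first last.
- by move=> x /=; rewrite /oneDsqr sqrrN.
- exact: continuous_oneDsqrV.
- by move=> x; rewrite invr_ge0 (le_trans _ (oneDsqr_ge1 x)).
by rewrite -set_itvcy integral0y_oneDsqr -EFinM; congr EFin; field.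
Qed.

Lemma integral_cauchy (c w : R) : 0 < c ->
  (\int[mu]_y (c / (c ^+ 2 + (y - w) ^+ 2))%:E = pi%:E)%E.
Proof.
move=> c0; rewrite -integralT_oneDsqrV.
pose F (y : R) := (y - w) / c.
have dF (y : R) : is_derive y (1 : R) F c^-1.
  by rewrite /F; apply: is_derive_eq; rewrite /GRing.scale /=; ring.
have F'E : F^`()%classic = cst c^-1.
  by apply/funext => y; rewrite derive1E derive_val.
rewrite (@increasing_ge0_integration_by_substitutionT R F
  (fun x => (oneDsqr x)^-1)).
- apply: eq_integral => /= y _; congr EFin; rewrite F'E.
  change (c / (c ^+ 2 + (y - w) ^+ 2) = (1 + ((y - w) / c) ^+ 2)^-1 * c^-1).
  have cw : c ^+ 2 + (y - w) ^+ 2 != 0.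
    by rewrite gt_eqF// ltr_wpDr ?sqr_ge0// exprn_gt0.
  by field; rewrite cw lt0r_neq0.
- by move=> x y xy; rewrite /F ltr_pM2r ?invr_gt0// ltrD2r.
- by rewrite F'E; exact: cst_continuous.
- by rewrite F'E; exact: is_cvg_cst.
- by rewrite F'E; exact: is_cvg_cst.
- by move=> y; exact: ex_derive.
- rewrite /F; apply: gt0_cvgMlNy; first by rewrite invr_gt0.
  exact: cvg_addrr_Ny.
- rewrite /F; apply: gt0_cvgMly; first by rewrite invr_gt0.
  exact: cvg_addrr.
- exact: continuous_oneDsqrV.
- by move=> x; rewrite invr_ge0 (le_trans _ (oneDsqr_ge1 x)).
Qed.

Lemma integrable_cauchy (c w : R) : 0 < c ->
  mu.-integrable setT (EFin \o (fun y : R => c / (c ^+ 2 + (y - w) ^+ 2))).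
Proof.
move=> c0; have c20 y : 0 < c ^+ 2 + (y - w) ^+ 2.
  by rewrite ltr_wpDr ?sqr_ge0// exprn_gt0.
apply/integrableP; split.
  apply/measurable_EFinP; apply: continuous_measurable_fun => y.
  apply: cvgM; first exact: cvg_cst.
  apply: cvgV; first by rewrite gt_eqF.
  apply: cvgD; first exact: cvg_cst.
  apply: (@cvgM _ _ _ _ (fun y => y - w) (fun y => y - w)) => //;
    by apply: cvgB => //; exact: cvg_cst.
under eq_integral do rewrite /= ger0_norm ?divr_ge0 ?(ltW c0) ?(ltW (c20 _))//.
by rewrite integral_cauchy// ltry.
Qed.

End Kernels.

(** * The Plancherel identity *)

Section Plancherel.
Context {R : realType}.
Local Notation mu := (@lebesgue_measure R).

Lemma measurable_Rintegral_param (f : R * R -> R) : measurable_fun setT f ->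
  measurable_fun setT (fun x : R => \int[mu]_y f (x, y)).
Proof.
move=> mf.
apply: (@measurableT_comp _ _ _ _ _ _ fine); first exact: fine_measurable.
under eq_fun do rewrite integralE.
apply: emeasurable_funB.
  rewrite [X in measurable_fun _ X](_ : _ =
    fubini_F mu ((EFin \o f)^\+)%E); last by rewrite /fubini_F !unlock.
  apply: measurable_fun_fubini_tonelli_F => //.
  by apply: measurable_funepos; apply/measurable_EFinP.
rewrite [X in measurable_fun _ X](_ : _ =
  fubini_F mu ((EFin \o f)^\-)%E); last by rewrite /fubini_F !unlock.
apply: measurable_fun_fubini_tonelli_F => //.
by apply: measurable_funeneg; apply/measurable_EFinP.
Qed.

(** Every interchange of integrals below couples two integrable functions by a bounded kernel: the
    Abel means, and the symmetry of the cosine and sine transforms. Integrability on the plane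
    follows by Tonelli from the bound |phi| |psi| C. *)
Lemma Rintegral_Fubini_bounded (phi psi : R -> R) (K : R -> R -> R) (C : R) :
  mu.-integrable setT (EFin \o phi) -> mu.-integrable setT (EFin \o psi) ->
  measurable_fun setT (fun z : R * R => K z.1 z.2) ->
  (forall x y, `|K x y| <= C) ->
  \int[mu]_x (phi x * \int[mu]_y (psi y * K x y)) =
  \int[mu]_y (psi y * \int[mu]_x (phi x * K x y)).
Proof.
move=> iphi ipsi mK KC.
have mphi : measurable_fun setT phi.
  by apply/measurable_EFinP; exact: measurable_int iphi.
have mpsi : measurable_fun setT psi.
  by apply/measurable_EFinP; exact: measurable_int ipsi.
have mKx x : measurable_fun setT (K x).
  by apply: (measurableT_comp mK (measurable_pair1 x)).
have mKy y : measurable_fun setT (K ^~ y).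
  by apply: (measurableT_comp mK (measurable_pair2 y)).
have ix x : mu.-integrable setT (EFin \o (fun y => psi y * K x y)).
  by apply: (@integrableM_bounded _ _ psi (K x) C) => // z _; exact: KC.
have iy y : mu.-integrable setT (EFin \o (fun x => phi x * K x y)).
  apply: (@integrableM_bounded _ _ phi (K ^~ y) C) => // z _; exact: KC.
pose f (z : R * R) := (phi z.1 * (psi z.2 * K z.1 z.2))%:E.
have mf : measurable_fun setT f.
  apply/measurable_EFinP; apply: measurable_funM.
    exact: measurableT_comp mphi measurable_fst.
  by apply: measurable_funM => //; exact: measurableT_comp mpsi measurable_snd.
have fi : (mu \x mu)%E.-integrable setT f.
  apply/integrable12ltyP => //=.
  pose c := \int[mu]_y `|psi y|.
  apply: (@le_lt_trans _ _ (\int[mu]_x (`|phi x| * (c * C))%:E)%E); last first.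
    have := @integrableM_bounded _ setT (fun x => `|phi x|)
      (cst (c * C)) (`|c * C|) measurableT.
    move=> /(_ (integrable_norm iphi) (measurable_cst _) (fun _ _ => lexx _)).
    by move/integrable_lty; exact.
  apply: ge0_le_integral => //.
  - by move=> x _; apply: integral_ge0.
  - rewrite [X in measurable_fun _ X](_ : _ = fubini_F mu (abse \o f)%E)//.
    apply: measurable_fun_fubini_tonelli_F => //.
      exact: measurableT_comp.
    by move=> z; exact: abse_ge0.
  - apply/measurable_EFinP; apply: measurable_funM => //.
    exact: measurableT_comp.
  move=> x _.
  have H : (\int[mu]_y (`|psi y| * (`|phi x| * C))%:E =
      (`|phi x| * (c * C))%:E)%E.
    under eq_integral do rewrite EFinM.
    rewrite integralZr//=; last exact: integrable_norm ipsi.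
    rewrite -(@fineK _ (\int[mu]_x (`|psi x|)%:E)%E).
      by rewrite -EFinM /c /Rintegral; congr EFin; ring.
    by apply: integrable_fin_num => //; exact: integrable_norm ipsi.
  rewrite -H; apply: ge0_le_integral => //=.
  - apply/measurable_EFinP; apply: measurableT_comp => //.
    exact: measurable_funM (measurable_cst _) (measurable_funM mpsi (mKx x)).
  - apply/measurable_EFinP; apply: measurable_funM => //.
    exact: measurableT_comp.
  - move=> y _; rewrite lee_fin !normrM mulrCA.
    by rewrite ler_wpM2l// ler_wpM2l.
have := Fubini fi.
rewrite /Rintegral => E.
rewrite (_ : (\int[mu]_x (phi x * fine (\int[mu]_y (psi y * K x y)%:E))%:E)%E
  = (\int[mu]_x \int[mu]_y f (x, y))%E); last first.
  apply: eq_integral => x _; rewrite /f /=.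
  under [RHS]eq_integral do rewrite EFinM.
  rewrite [RHS](integralZl measurableT (ix x) (phi x)) EFinM fineK//.
  exact: integrable_fin_num (ix x).
rewrite E; congr fine; apply: eq_integral => y _; rewrite /f /=.
under eq_integral do rewrite mulrCA EFinM.
rewrite [LHS](integralZl measurableT (iy y) (psi y)) EFinM fineK//.
exact: integrable_fin_num (iy y).
Qed.

Lemma continuous_Rintegral_comp (A K : R -> R) :
  mu.-integrable setT (EFin \o A) -> continuous K -> (forall x, `|K x| <= 1) ->
  continuous (fun t => \int[mu]_x (A x * K (x * t))).
Proof.
move=> iA cK K1 t.
have mKt (s : R) : measurable_fun setT (fun x : R => K (x * s)).
  apply: measurableT_comp; first exact: continuous_measurable_fun.
  exact: measurable_funM.
have ts : t \in (`]t - 1, t + 1[%classic : set R).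
  by rewrite inE /= in_itv/= ltrBlDr ltrDl ltr01.
apply: (@continuity_under_integral R _ _ mu (fun t x => A x * K (x * t)) setT
  measurableT (t - 1) (t + 1) _ _ (fun x => `|A x|) _ _ t ts).
- by move=> s _; apply: (@integrableM_bounded _ _ _ _ 1).
- apply: aeW => x _ s _; apply: cvgM; first exact: cvg_cst.
  apply: continuous_comp; last exact: cK.
  by apply: cvgMl_tmp; exact: cvg_id.
- exact: integrable_norm iA.
- by move=> s _; apply: aeW => x _; rewrite normrM ler_piMr.
Qed.

Definition fourier_cos (A : R -> R) (t : R) := \int[mu]_x (A x * cos (x * t)).
Definition fourier_sin (A : R -> R) (t : R) := \int[mu]_x (A x * sin (x * t)).

Lemma normr_cos_le1 (x : R) : `|cos x| <= 1.
Proof. by rewrite ler_norml cos_geN1 cos_le1. Qed.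

Lemma normr_sin_le1 (x : R) : `|sin x| <= 1.
Proof. by rewrite ler_norml sin_geN1 sin_le1. Qed.

Lemma continuous_fourier_cos (A : R -> R) :
  mu.-integrable setT (EFin \o A) -> continuous (fourier_cos A).
Proof.
move=> iA; apply: continuous_Rintegral_comp => //; first exact: continuous_cos.
exact: normr_cos_le1.
Qed.

Lemma continuous_fourier_sin (A : R -> R) :
  mu.-integrable setT (EFin \o A) -> continuous (fourier_sin A).
Proof.
move=> iA; apply: continuous_Rintegral_comp => //; first exact: continuous_sin.
exact: normr_sin_le1.
Qed.

Lemma integrable_mul_cos (A : R -> R) (t : R) :
  mu.-integrable setT (EFin \o A) ->
  mu.-integrable setT (EFin \o (fun x => A x * cos (x * t))).
Proof.
move=> iA; apply: (@integrableM_bounded _ _ _ _ 1) => //.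
  apply: measurableT_comp; last exact: measurable_funM.
  by apply: continuous_measurable_fun; exact: continuous_cos.
by move=> x _; exact: normr_cos_le1.
Qed.

Lemma integrable_mul_sin (A : R -> R) (t : R) :
  mu.-integrable setT (EFin \o A) ->
  mu.-integrable setT (EFin \o (fun x => A x * sin (x * t))).
Proof.
move=> iA; apply: (@integrableM_bounded _ _ _ _ 1) => //.
  apply: measurableT_comp; last exact: measurable_funM.
  by apply: continuous_measurable_fun; exact: continuous_sin.
by move=> x _; exact: normr_sin_le1.
Qed.

Lemma normr_fourier_cos (A : R -> R) (t : R) :
  mu.-integrable setT (EFin \o A) ->
  `|fourier_cos A t| <= \int[mu]_x `|A x|.
Proof.
move=> iA; apply: le_trans.
  by apply: le_normr_Rintegral => //; exact: integrable_mul_cos.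
apply: le_Rintegral => //; first exact: integrable_norm (integrable_mul_cos _ iA).
  exact: integrable_norm iA.
by move=> x _; rewrite normrM ler_piMr// normr_cos_le1.
Qed.

Lemma normr_fourier_sin (A : R -> R) (t : R) :
  mu.-integrable setT (EFin \o A) ->
  `|fourier_sin A t| <= \int[mu]_x `|A x|.
Proof.
move=> iA; apply: le_trans.
  by apply: le_normr_Rintegral => //; exact: integrable_mul_sin.
apply: le_Rintegral => //; first exact: integrable_norm (integrable_mul_sin _ iA).
  exact: integrable_norm iA.
by move=> x _; rewrite normrM ler_piMr// normr_sin_le1.
Qed.

(** The addition formula for the cosine. It turns a product of transforms into one integral whose
    kernel depends on x - w, the source of the convolution in the Abel means. *)
Lemma fourier_cosB (A : R -> R) (w t : R) :
  mu.-integrable setT (EFin \o A) ->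
  \int[mu]_x (A x * cos ((x - w) * t)) =
  fourier_cos A t * cos (w * t) + fourier_sin A t * sin (w * t).
Proof.
move=> iA.
rewrite -RintegralZr//; last exact: integrable_mul_cos.
rewrite -RintegralZr//; last exact: integrable_mul_sin.
rewrite -RintegralD//.
- apply: eq_Rintegral => x _; rewrite mulrBl cosB; ring.
- apply: (@integrableM_bounded _ _ _ (cst (cos (w * t))) `|cos (w * t)|) => //.
  exact: integrable_mul_cos.
- apply: (@integrableM_bounded _ _ _ (cst (sin (w * t))) `|sin (w * t)|) => //.
  exact: integrable_mul_sin.
Qed.

(* Abel means turn the energy of the transform into a Poisson average. *)
Lemma abel_fourier_sqr (A : R -> R) (e : R) : 0 < e ->
  mu.-integrable setT (EFin \o A) ->
  \int[mu]_t (expR (- (e * `|t|)) *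
     (fourier_cos A t ^+ 2 + fourier_sin A t ^+ 2)) =
  \int[mu]_w (A w * \int[mu]_x (A x * (2 * e / (e ^+ 2 + (x - w) ^+ 2)))).
Proof.
move=> e0 iA; have iG := integrable_abel e0.
have mA : measurable_fun setT A.
  by apply/measurable_EFinP; exact: measurable_int iA.
have mcos (f : R * R -> R) : measurable_fun setT f ->
    measurable_fun setT (fun z => cos (f z)).
  move=> mf; apply: (@measurableT_comp _ _ _ _ _ _ (@cos R)) mf.
  by apply: continuous_measurable_fun; exact: continuous_cos.
have msin (f : R * R -> R) : measurable_fun setT f ->
    measurable_fun setT (fun z => sin (f z)).
  move=> mf; apply: (@measurableT_comp _ _ _ _ _ _ (@sin R)) mf.
  by apply: continuous_measurable_fun; exact: continuous_sin.
pose B t w := fourier_cos A t * cos (w * t) + fourier_sin A t * sin (w * t).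
(* One factor of each square is written out as an integral over w; the other remains as a bounded
   continuous function of t. The first interchange then moves w outside. *)
transitivity (\int[mu]_t (expR (- (e * `|t|)) * \int[mu]_w (A w * B t w))).
  apply: eq_Rintegral => t _; congr (_ * _).
  rewrite [fourier_cos A t ^+ 2]expr2 [fourier_sin A t ^+ 2]expr2.
  rewrite {2}/fourier_cos {2}/fourier_sin.
  rewrite -RintegralZl//; last exact: integrable_mul_cos.
  rewrite -RintegralZl//; last exact: integrable_mul_sin.
  rewrite -RintegralD//.
  - by apply: eq_Rintegral => x _; rewrite /B; ring.
  - under eq_fun do rewrite mulrC.
    apply: (@integrableM_bounded _ _ _ (cst (fourier_cos A t))
      `|fourier_cos A t|) => //.
    exact: integrable_mul_cos.
  - under eq_fun do rewrite mulrC.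
    apply: (@integrableM_bounded _ _ _ (cst (fourier_sin A t))
      `|fourier_sin A t|) => //.
    exact: integrable_mul_sin.
have mB : measurable_fun setT (fun z : R * R => B z.1 z.2).
  apply: measurable_funD; apply: measurable_funM.
  + apply: (@measurableT_comp _ _ _ _ _ _ (fourier_cos A)) measurable_fst.
    by apply: continuous_measurable_fun; exact: continuous_fourier_cos.
  + by apply: mcos; apply: measurable_funM.
  + apply: (@measurableT_comp _ _ _ _ _ _ (fourier_sin A)) measurable_fst.
    by apply: continuous_measurable_fun; exact: continuous_fourier_sin.
  + by apply: msin; apply: measurable_funM.
have Bb t w : `|B t w| <= 2 * \int[mu]_x `|A x|.
  rewrite /B (le_trans (ler_normD _ _))// !normrM [leRHS]mulrDl mul1r.
  by apply: lerD; rewrite -[leRHS]mulr1 ler_pM// ?normr_cos_le1 ?normr_sin_le1//;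
    [exact: normr_fourier_cos|exact: normr_fourier_sin].
rewrite (Rintegral_Fubini_bounded iG iA mB Bb).
apply: eq_Rintegral => w _; congr (_ * _).
rewrite /B; under eq_Rintegral do rewrite -fourier_cosB//.
(* The second interchange puts the t integral innermost, where the cosine transform of the Abel
   weight is known. *)
rewrite (@Rintegral_Fubini_bounded _ _ (fun t x => cos ((x - w) * t)) 1) //.
- by apply: eq_Rintegral => x _; rewrite integral_abel_cos.
- apply: mcos; apply: measurable_funM => //.
  by apply: measurable_funB.
- by move=> t x; exact: normr_cos_le1.
Qed.

(* Enough regularity for Abel means to converge almost everywhere to the function
   itself. *)
Definition truncated_continuous (a b : R) (A : R -> R) : Prop :=
  [/\ measurable_fun setT A, exists M : R, forall x, `|A x| <= M,
      forall x, x \notin `[a, b] -> A x = 0 &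
      forall x, x != a -> x != b -> {for x, continuous A}].

Lemma integrable_bounded_support (a b M : R) (A : R -> R) :
  measurable_fun setT A -> (forall x, `|A x| <= M) ->
  (forall x, x \notin `[a, b] -> A x = 0) ->
  mu.-integrable setT (EFin \o A).
Proof.
move=> mA AM A0.
pose I : set R := `[a, b]%classic.
have iI : mu.-integrable setT (EFin \o (\1_I : R -> R)).
  exact: integrable_indic_itv.
have := @integrableM_bounded _ setT _ A M measurableT iI mA (fun x _ => AM x).
apply: eq_integrable => // x _ /=; congr EFin.
rewrite indicE; have [xI|xI] := boolP (x \in I); first by rewrite mul1r.
by rewrite A0 ?mulr0//; apply: contra xI => xI; rewrite inE.
Qed.

Lemma truncated_continuous_integrable (a b : R) (A : R -> R) :
  truncated_continuous a b A -> mu.-integrable setT (EFin \o A).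
Proof. by case=> mA [M AM] A0 _; exact: integrable_bounded_support mA AM A0. Qed.

Lemma integrable_sqr_bounded (A : R -> R) (M : R) :
  mu.-integrable setT (EFin \o A) -> (forall x, `|A x| <= M) ->
  mu.-integrable setT (EFin \o (fun x => A x ^+ 2)).
Proof.
move=> iA AM; under eq_fun do rewrite expr2.
apply: (@integrableM_bounded _ _ _ _ M) => //.
by apply/measurable_EFinP; exact: measurable_int iA.
Qed.

(* The Poisson kernel splits into a part of mass 2 pi near w and a remainder
   dominated by e times a fixed integrable function. *)
Lemma poisson_average_bound (A : R -> R) (w M r d e : R) :
  mu.-integrable setT (EFin \o A) -> (forall x, `|A x| <= M) ->
  0 < d -> 0 < e -> 0 <= r ->
  (forall x, `|x - w| < d -> `|A x - A w| <= r) ->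
  `|\int[mu]_x (A x * (2 * e / (e ^+ 2 + (x - w) ^+ 2))) - 2 * pi * A w| <=
    2 * pi * r + e * (4 * pi * M * (1 + (d ^+ 2)^-1)).
Proof.
move=> iA AM d0 e0 r0 Ar.
have M0 : 0 <= M by exact: le_trans (AM 0).
pose k (c x : R) : R := c / (c ^+ 2 + (x - w) ^+ 2).
have ik (c : R) : 0 < c -> mu.-integrable setT (EFin \o k c) by exact: integrable_cauchy.
have intk (c : R) : 0 < c -> \int[mu]_x k c x = pi.
  by move=> c0; rewrite /Rintegral integral_cauchy.
have k0 (c x : R) : 0 < c -> 0 <= k c x.
  by move=> c0; rewrite /k divr_ge0 ?(ltW c0)// addr_ge0 ?sqr_ge0.
have mA : measurable_fun setT A.
  by apply/measurable_EFinP; exact: measurable_int iA.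
have ikZ (c s : R) : 0 < c -> mu.-integrable setT (EFin \o (fun x => s * k c x)).
  by move=> c0; rewrite /comp; under eq_fun do rewrite EFinM;
    apply: integrableZl => //; exact: ik.
have iAk : mu.-integrable setT (EFin \o (fun x => (2 * k e x) * A x)).
  by apply: (@integrableM_bounded _ _ _ _ M) => //; exact: ikZ.
have iAk' : mu.-integrable setT (EFin \o (fun x => (2 * k e x) * (A x - A w))).
  apply: (@integrableM_bounded _ _ _ _ (M + M)) => //; first exact: ikZ.
    exact: measurable_funB.
  by move=> x _; rewrite (le_trans (ler_normB _ _))// lerD.
have -> : \int[mu]_x (A x * (2 * e / (e ^+ 2 + (x - w) ^+ 2))) =
    \int[mu]_x ((2 * k e x) * A x).
  by apply: eq_Rintegral => x _; rewrite /k mulrC mulrA.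
have -> : 2 * pi * A w = \int[mu]_x ((2 * A w) * k e x).
  by rewrite RintegralZl ?intk//; [ring|exact: ik].
rewrite -RintegralB//; last exact: ikZ.
have -> : \int[mu]_x (2 * k e x * A x - 2 * A w * k e x) =
    \int[mu]_x ((2 * k e x) * (A x - A w)).
  by apply: eq_Rintegral => x _; ring.
apply: (le_trans (le_normr_Rintegral measurableT iAk')).
(* Where |x - w| >= d, writing z = (x - w)^2, one has 1 / (e^2 + z) <= 1 / z <= (1 + 1 / d^2) / (1 +
   z). The far part is thus dominated by s times the kernel of width 1, which does not depend on
   e. *)
pose s := 4 * M * e * (1 + (d ^+ 2)^-1).
have s0 : 0 <= s.
  by rewrite !mulr_ge0// ?(ltW e0)// addr_ge0// invr_ge0 sqr_ge0.
rewrite [leRHS](_ : _ = \int[mu]_x ((2 * r) * k e x + s * k 1 x)); last first.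
  rewrite RintegralD//; [|exact: ikZ|exact: ikZ].
  rewrite (RintegralZl _ measurableT (ik _ e0)).
  by rewrite (RintegralZl _ measurableT (ik _ ltr01)) !intk// /s; ring.
apply: le_Rintegral => //.
- exact: integrable_norm iAk'.
- have := integrableD measurableT (ikZ e (2 * r) e0) (ikZ 1 s ltr01).
  by apply: eq_integrable.
move=> x _.
have ke0 : 0 <= 2 * k e x by apply: mulr_ge0 => //; exact: k0.
have sk0 : 0 <= s * k 1 x by apply: mulr_ge0 => //; exact: k0.
rewrite normrM (ger0_norm ke0).
have [xd|xd] := ltP `|x - w| d.
  apply: (@le_trans _ _ ((2 * k e x) * r)).
    by apply: ler_wpM2l => //; exact: Ar.
  by rewrite mulrAC lerDl.
apply: (@le_trans _ _ (2 * k e x * (2 * M))).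
  apply: ler_wpM2l => //.
  by rewrite (le_trans (ler_normB _ _))// mulrDl mul1r lerD.
apply: (@le_trans _ _ (s * k 1 x)); last first.
  by rewrite lerDr mulrAC mulr_ge0.
have z0 : d ^+ 2 <= (x - w) ^+ 2.
  by rewrite -[leRHS](real_normK (num_real _)) ler_sqr ?nnegrE ?normr_ge0 ?(ltW d0).
have d20 : 0 < d ^+ 2 by rewrite exprn_gt0.
rewrite /s /k; move: z0; set z := (x - w) ^+ 2 => z0.
have zp : 0 < z by exact: lt_le_trans z0.
have e20 : 0 <= e ^+ 2 by exact: sqr_ge0.
rewrite expr1n [leLHS](_ : _ = (4 * M * e) * (e ^+ 2 + z)^-1); last by ring.
rewrite mul1r -[leRHS]mulrA; apply: ler_wpM2l.
  by rewrite !mulr_ge0// ltW.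
apply: (@le_trans _ _ z^-1).
  by rewrite lef_pV2 ?posrE// ?lerDr// ltr_wpDl.
rewrite ler_pdivlMr; last by rewrite addr_gt0.
rewrite mulrDr mulr1 mulVf ?gt_eqF// addrC lerD2l lef_pV2 ?posrE//.
Qed.

Lemma poisson_average_cvg (A : R -> R) (w M : R) :
  mu.-integrable setT (EFin \o A) -> (forall x, `|A x| <= M) ->
  {for w, continuous A} ->
  \int[mu]_x (A x *
     (2 * n.+1%:R^-1 / (n.+1%:R^-1 ^+ 2 + (x - w) ^+ 2))) @[n --> \oo]
  --> 2 * pi * A w.
Proof.
move=> iA AM cA.
have pi0 := pi_gt0 R.
apply/cvgrPdist_le => eps eps0.
pose r := eps / (4 * pi).
have r0 : 0 < r by rewrite divr_gt0// mulr_gt0.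
move/cvgrPdist_le : cA => /(_ r r0) /nbhs_ballP[d /= d0 dA].
have := @cvg_harmonic R; move/cvgrPdist_le.
set C := 4 * pi * M * (1 + (d ^+ 2)^-1).
have C0 : 0 <= C.
  rewrite /C !mulr_ge0// ?(ltW pi0)//; first exact: le_trans (AM 0).
  by rewrite addr_ge0// invr_ge0 sqr_ge0.
(* The added 1 allows for C = 0. *)
have C1 : 0 < C + 1 by rewrite ltr_wpDl.
move=> /(_ (eps / 2 / (C + 1))).
rewrite !divr_gt0// => /(_ isT); apply: filterS => n /=.
rewrite sub0r normrN ger0_norm ?invr_ge0// => nC.
rewrite distrC; apply: le_trans.
  apply: (@poisson_average_bound A w M r d n.+1%:R^-1) => //.
  - exact: ltW.
  - by move=> x xd; rewrite distrC; apply: dA; rewrite /ball/= distrC.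
rewrite -/C [leRHS](splitr eps) lerD//.
  have pin0 : pi != 0 :> R by rewrite gt_eqF.
  rewrite le_eqVlt; apply/orP; left; apply/eqP; rewrite /r.
  by move: pin0; move: (pi : R) => p p0; field.
apply: (@le_trans _ _ (eps / 2 / (C + 1) * (C + 1))).
  by rewrite ler_pM// ?invr_ge0// lerDl.
by rewrite divfK// gt_eqF.
Qed.

(** The Abel means of parameter 1 / (n + 1) have two limits. In t the weights increase to 1 and
    monotone convergence applies, even before the energy is known to be finite. In w the Poisson
    averages are bounded by 2 pi M and converge off the null set {a, b}, so dominated convergence
    applies. *)
Lemma integral_fourier_sqr (a b : R) (A : R -> R) :
  truncated_continuous a b A ->
  (\int[mu]_t (fourier_cos A t ^+ 2 + fourier_sin A t ^+ 2)%:E =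
   (2 * pi * \int[mu]_x A x ^+ 2)%:E)%E.
Proof.
move=> tA; have iA := truncated_continuous_integrable tA.
case: tA => mA [M AM] _ cA.
have M0 : 0 <= M by exact: le_trans (AM 0).
pose e (n : nat) : R := n.+1%:R^-1.
have e0 n : 0 < e n by rewrite invr_gt0 ltr0n.
pose H t := fourier_cos A t ^+ 2 + fourier_sin A t ^+ 2.
have H0 t : 0 <= H t by rewrite addr_ge0 ?sqr_ge0.
have cH : continuous H.
  move=> t; apply: cvgD.
    apply: (@continuous_comp _ _ _ (fourier_cos A) (fun x => x ^+ 2)).
      exact: continuous_fourier_cos.
    exact: exprn_continuous.
  apply: (@continuous_comp _ _ _ (fourier_sin A) (fun x => x ^+ 2)).
    exact: continuous_fourier_sin.
  exact: exprn_continuous.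
have mH : measurable_fun setT H by exact: continuous_measurable_fun.
pose G (n : nat) (t : R) : R := expR (- (e n * `|t|)).
have mG n : measurable_fun setT (G n).
  by apply: continuous_measurable_fun; exact: continuous_abel.
have lim1 : (\int[mu]_t (G n t * H t)%:E @[n --> \oo] -->
    \int[mu]_t (H t)%:E)%E.
  have -> : (\int[mu]_t (H t)%:E =
      \int[mu]_t (limn (fun n => (G n t * H t)%:E)))%E.
    apply: eq_integral => t _; apply/esym/cvg_lim => //.
    apply: cvg_EFin; first by apply: nearW.
    rewrite -[X in _ --> X]mul1r; apply: cvgMr_tmp.
    rewrite -expR0; apply: continuous_cvg; first exact: continuous_expR.
    rewrite -oppr0; apply: cvgN; rewrite -(mul0r `|t|); apply: cvgMr_tmp.
    exact: cvg_harmonic.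
  apply: cvg_monotone_convergence => //.
  - by move=> n; apply/measurable_EFinP; exact: measurable_funM (mG n) mH.
  - by move=> n t _; rewrite lee_fin mulr_ge0// expR_ge0.
  - move=> t _ m n mn; rewrite lee_fin ler_wpM2r// ler_expR lerN2 ler_wpM2r//.
    by rewrite lef_pV2 ?posrE ?ltr0n// ler_nat.
pose P (n : nat) (w : R) := \int[mu]_x (A x * (2 * e n / (e n ^+ 2 + (x - w) ^+ 2))).
have GH n : (\int[mu]_t (G n t * H t)%:E = (\int[mu]_w (A w * P n w))%:E)%E.
  rewrite -(abel_fourier_sqr (e0 n) iA) /Rintegral fineK//.
  apply: integrable_fin_num => //.
  apply: (@integrableM_bounded _ _ _ _
    ((\int[mu]_x `|A x|) ^+ 2 + (\int[mu]_x `|A x|) ^+ 2)) => //.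
    exact: integrable_abel.
  move=> t _; rewrite ger0_norm ?addr_ge0 ?sqr_ge0//.
  have le_sqr_norm (x y : R) : `|x| <= y -> x ^+ 2 <= y ^+ 2.
    by move=> xy; rewrite -(real_normK (num_real x)) ler_sqr ?nnegrE//;
      apply: le_trans xy.
  by apply: lerD; apply: le_sqr_norm;
    [exact: normr_fourier_cos|exact: normr_fourier_sin].
have mP n : measurable_fun setT (P n).
  pose f (z : R * R) := A z.2 * (2 * e n / (e n ^+ 2 + (z.2 - z.1) ^+ 2)).
  apply: (@measurable_Rintegral_param f).
  apply: measurable_funM; first exact: measurableT_comp mA measurable_snd.
  pose k (s : R) := 2 * e n / (e n ^+ 2 + s ^+ 2).
  have ck : continuous k.
    move=> s; apply: cvgM; first exact: cvg_cst.
    apply: cvgV; first by rewrite gt_eqF// ltr_wpDr ?sqr_ge0// exprn_gt0.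
    by apply: cvgD; [exact: cvg_cst|exact: exprn_continuous].
  apply: (@measurableT_comp _ _ _ _ _ _ k); first exact: continuous_measurable_fun.
  exact: measurable_funB measurable_snd measurable_fst.
have PM n w : `|P n w| <= 2 * pi * M.
  have ik : mu.-integrable setT
      (EFin \o (fun x => 2 * (e n / (e n ^+ 2 + (x - w) ^+ 2)))).
    rewrite /comp; under eq_fun do rewrite EFinM.
    by apply: integrableZl => //; exact: integrable_cauchy.
  have iAk : mu.-integrable setT
      (EFin \o (fun x => A x * (2 * e n / (e n ^+ 2 + (x - w) ^+ 2)))).
    under eq_fun do rewrite mulrC -mulrA.
    exact: (integrableM_bounded measurableT ik mA (fun x _ => AM x)).
  apply: (le_trans (le_normr_Rintegral measurableT iAk)).
  have -> : 2 * pi * M =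
      \int[mu]_x (M * (2 * (e n / (e n ^+ 2 + (x - w) ^+ 2)))).
    rewrite RintegralZl// RintegralZl//; last exact: integrable_cauchy.
    by rewrite /Rintegral integral_cauchy//=; ring.
  apply: le_Rintegral => //; first exact: integrable_norm iAk.
    rewrite /comp; under eq_fun do rewrite EFinM.
    exact: integrableZl.
  move=> x _; rewrite normrM -mulrA [X in _ * X <= _]ger0_norm.
    rewrite ler_wpM2r// mulr_ge0// divr_ge0 ?(ltW (e0 n))//.
    by rewrite addr_ge0 ?sqr_ge0.
  by rewrite mulr_ge0// divr_ge0 ?(ltW (e0 n))// addr_ge0 ?sqr_ge0.
have iA2 := integrable_sqr_bounded iA AM.
have lim2 : (\int[mu]_w (A w * P n w)%:E @[n --> \oo] -->
    \int[mu]_w (2 * pi * A w ^+ 2)%:E)%E.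
  have [] // := @dominated_convergence _ _ R mu setT measurableT
    (fun n w => (A w * P n w)%:E) (fun w => (2 * pi * A w ^+ 2)%:E)
    (fun w => (`|A w| * (2 * pi * M))%:E).
  - by move=> n; apply/measurable_EFinP; exact: measurable_funM mA (mP n).
  - apply/measurable_EFinP.
    exact: measurable_funM (measurable_cst _) (measurable_funX 2 mA).
  - exists [set a; b]; split; first by apply: measurableU; exact: measurable_set1.
      have : countable [set a; b] by exact: finite_set_countable.
      exact: countable_lebesgue_measure0.
    move=> w /= /not_implyP[_ nw]; apply/not_notP => wab; apply: nw.
    have [wa wb] : w != a /\ w != b.
      by split; apply/eqP => E; apply: wab; [left|right].
    apply: cvg_EFin; first exact: nearW.
    rewrite (_ : 2 * pi * A w ^+ 2 = A w * (2 * pi * A w)); last by ring.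
    apply: cvgMl_tmp; apply: (poisson_average_cvg iA AM); exact: cA.
  - rewrite /comp; under eq_fun do rewrite EFinM.
    apply: integrableZr => //; exact: integrable_norm iA.
  - apply: aeW => w n _; rewrite lee_fin normrM ler_wpM2l//; exact: PM.
have iAP n := integrableM_bounded measurableT iA (mP n) (fun x _ => PM n x).
have GH' n : (\int[mu]_t (G n t * H t)%:E = \int[mu]_w (A w * P n w)%:E)%E.
  by rewrite GH /Rintegral fineK//; exact: integrable_fin_num (iAP n).
move: lim1; under eq_fun do rewrite GH'.
move=> /(cvg_unique (@ereal_hausdorff R) lim2) <-.
under eq_integral do rewrite EFinM.
rewrite [LHS](integralZl measurableT iA2 (2 * pi)) [RHS]EFinM /Rintegral fineK//.
exact: integrable_fin_num iA2.
Qed.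

End Plancherel.

(** * Complex-valued functions in L2 *)

Section L2energy.
Context {R : realType}.
Local Notation mu := (@lebesgue_measure R).
Local Notation Re := complex.Re.
Local Notation Im := complex.Im.
Implicit Types (f g v V : R -> R[i]).

Definition sqnorm (z : R[i]) : R := Re z ^+ 2 + Im z ^+ 2.

(** Plancherel's identity and the inversion error are exact identities between squared norms.
    Computing with squares, valued in the extended reals, delays the passage to [L2norm] to the
    end. *)
Definition energy f : \bar R := (\int[mu]_t (sqnorm (f t))%:E)%E.

Lemma sqnorm_ge0 z : 0 <= sqnorm z.
Proof. by rewrite addr_ge0 ?sqr_ge0. Qed.

Lemma sqnormM z1 z2 : sqnorm (z1 * z2) = sqnorm z1 * sqnorm z2.
Proof. by case: z1 => a b; case: z2 => c d; rewrite /sqnorm /=; ring. Qed.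

Lemma sqnormB z1 z2 : sqnorm (z1 - z2) =
  sqnorm z1 + sqnorm z2 - 2 * (Re z1 * Re z2 + Im z1 * Im z2).
Proof. by case: z1 => a b; case: z2 => c d; rewrite /sqnorm /=; ring. Qed.

Lemma sqnorm_real (c : R) : sqnorm (c%:C) = c ^+ 2.
Proof. by rewrite /sqnorm /= expr0n addr0. Qed.

Lemma energy_ge0 f : (0 <= energy f)%E.
Proof. by apply: integral_ge0 => t _; rewrite lee_fin sqnorm_ge0. Qed.

Lemma L2normE f : L2norm f = (energy f `^ 2^-1)%E.
Proof.
rewrite /L2norm unlock; congr (_ `^ _)%E; apply: eq_integral => t _.
rewrite abse_EFin poweR_EFin; congr EFin.
case: (f t) => a b /=; rewrite ger0_norm ?sqrtr_ge0//.
by rewrite powR_mulrn ?sqrtr_ge0// sqr_sqrtr// addr_ge0 ?sqr_ge0.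
Qed.

Lemma L2norm_le f (e : R) : 0 <= e ->
  (L2norm f <= e%:E)%E = (energy f <= (e ^+ 2)%:E)%E.
Proof.
move=> e0; rewrite L2normE.
have := energy_ge0 f; case: (energy f) => [r| |] r0 //.
  rewrite poweR_EFin !lee_fin powR12_sqrt//.
  by rewrite -[e in LHS]ger0_norm// -sqrtr_sqr ler_sqrt// sqr_ge0.
by rewrite poweRyr ?invr_neq0.
Qed.

Lemma L2norm_lty f : (L2norm f < +oo)%E = (energy f < +oo)%E.
Proof.
rewrite L2normE; have := energy_ge0 f; case: (energy f) => [r| |] r0 //.
  by rewrite poweR_EFin !ltry.
by rewrite poweRyr ?invr_neq0.
Qed.

Lemma L2norm_ge0 f : (0 <= L2norm f)%E.
Proof. by rewrite L2normE poweR_ge0. Qed.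

Lemma L2norm_cvg0 (T : Type) (F : set_system T) {FF : Filter F}
    (f_ : T -> R -> R[i]) :
  energy (f_ x) @[x --> F] --> 0%E -> L2norm (f_ x) @[x --> F] --> 0%E.
Proof.
move=> /fine_cvgP[Ffin Fcvg].
apply/fine_cvgP; split.
  apply: filterS Ffin => x; rewrite !ge0_fin_numE ?energy_ge0 ?L2norm_ge0//.
  by rewrite L2norm_lty.
apply/cvgrPdist_le => e e0.
have e20 : 0 < e ^+ 2 by rewrite exprn_gt0.
move/cvgrPdist_le : Fcvg => /(_ _ e20) Fcvg.
apply: filterS2 Ffin Fcvg => x xfin /=.
rewrite !sub0r !normrN !ger0_norm ?fine_ge0 ?energy_ge0 ?L2norm_ge0// => xe.
have : (energy (f_ x) <= (e ^+ 2)%:E)%E by rewrite -(fineK xfin) lee_fin.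
rewrite -(L2norm_le _ (ltW e0)) => H.
rewrite -lee_fin fineK//.
by rewrite ge0_fin_numE ?L2norm_ge0//; apply: le_lt_trans H _; rewrite ltry.
Qed.

Lemma measurable_sqnorm f : cmeasurable_fun setT f ->
  measurable_fun setT (fun t => sqnorm (f t)).
Proof. by case=> mr mi; apply: measurable_funD; exact: measurable_funX. Qed.

Lemma cmeasurableD d (T : measurableType d) (D : set T) (f g : T -> R[i]) :
  cmeasurable_fun D f -> cmeasurable_fun D g ->
  cmeasurable_fun D (f \+ g).
Proof.
move=> [fr fi] [gr gi]; split.
  rewrite (_ : (fun x => _) = (fun x => Re (f x) + Re (g x))).
    exact: measurable_funD.
  by apply/funext => x /=; rewrite raddfD.
rewrite (_ : (fun x => _) = (fun x => Im (f x) + Im (g x))).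
  exact: measurable_funD.
by apply/funext => x /=; rewrite raddfD.
Qed.

Lemma cmeasurableB d (T : measurableType d) (D : set T) (f g : T -> R[i]) :
  cmeasurable_fun D f -> cmeasurable_fun D g ->
  cmeasurable_fun D (f \- g).
Proof.
move=> [fr fi] [gr gi]; split.
  rewrite (_ : (fun x => _) = (fun x => Re (f x) - Re (g x))).
    exact: measurable_funB.
  by apply/funext => x /=; rewrite raddfB.
rewrite (_ : (fun x => _) = (fun x => Im (f x) - Im (g x))).
  exact: measurable_funB.
by apply/funext => x /=; rewrite raddfB.
Qed.

Lemma cmeasurableM d (T : measurableType d) (D : set T) (f g : T -> R[i]) :
  cmeasurable_fun D f -> cmeasurable_fun D g ->
  cmeasurable_fun D (f \* g).
Proof.
move=> [fr fi] [gr gi]; split.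
  rewrite (_ : (fun x => _) = (fun x => Re (f x) * Re (g x) - Im (f x) * Im (g x))).
    by apply: measurable_funB; exact: measurable_funM.
  by apply/funext => x /=; case: (f x) => ? ?; case: (g x).
rewrite (_ : (fun x => _) = (fun x => Re (f x) * Im (g x) + Im (f x) * Re (g x))).
  by apply: measurable_funD; exact: measurable_funM.
by apply/funext => x /=; case: (f x) => ? ?; case: (g x).
Qed.

Lemma measurable_normc f : cmeasurable_fun setT f ->
  measurable_fun setT (fun t => ComplexField.Normc.normc (f t)).
Proof.
move=> /measurable_sqnorm mf.
rewrite (_ : (fun t => _) = (fun t => Num.sqrt (sqnorm (f t)))).
  apply: measurableT_comp => //.
  by apply: continuous_measurable_fun; exact: sqrt_continuous.
by apply/funext => t; case: (f t).
Qed.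

(** Minkowski's inequality is applied to the moduli, after the pointwise triangle inequality for
    complex numbers. *)
Lemma L2normD f g : cmeasurable_fun setT f -> cmeasurable_fun setT g ->
  (L2norm (f \+ g)%R <= L2norm f + L2norm g)%E.
Proof.
move=> mf mg.
apply: (@le_trans _ _ (Lnorm mu 2%:E ((EFin \o ((fun t => ComplexField.Normc.normc (f t)) \+
   (fun t => ComplexField.Normc.normc (g t)))%R)))); last first.
  by apply: minkowski_EFin; [exact: measurable_normc|exact: measurable_normc|
    rewrite ler1n].
rewrite /L2norm !unlock; apply: gt0_ler_poweR; first by rewrite invr_ge0.
- by rewrite in_itv/= leey andbT; apply: integral_ge0 => t _; rewrite lee_fin powR_ge0.
- by rewrite in_itv/= leey andbT; apply: integral_ge0 => t _; rewrite lee_fin powR_ge0.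
pose n (z : R[i]) := ComplexField.Normc.normc z.
have n0 z : 0 <= n z by case: z => a b; rewrite sqrtr_ge0.
have nE (h : R -> R) : (forall t, 0 <= h t) ->
    (\int[mu]_t (`|(h t)%:E| `^ 2) = \int[mu]_t (h t ^+ 2)%:E)%E.
  move=> h0; apply: eq_integral => t _.
  by rewrite abse_EFin poweR_EFin ger0_norm// powR_mulrn.
have nfg t : 0 <= n (f t) + n (g t) by rewrite addr_ge0.
rewrite [leLHS](nE _ (fun t => n0 ((f \+ g) t))) [leRHS](nE _ nfg).
apply: ge0_le_integral => //.
- by move=> t _; rewrite lee_fin sqr_ge0.
- apply/measurable_EFinP; apply: measurable_funX.
  by apply: measurable_normc; exact: cmeasurableD.
- apply/measurable_EFinP; apply: measurable_funX.
  by apply: measurable_funD; exact: measurable_normc.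
- move=> t _; rewrite lee_fin ler_sqr ?nnegrE ?n0 ?addr_ge0//.
  exact: le_normcD.
Qed.

Lemma energy_oppr f : cmeasurable_fun setT f ->
  energy (fun t => f (- t)) = energy f.
Proof.
move=> /measurable_sqnorm mf.
rewrite /energy -[RHS](ge0_integral_oppr mf)// => t; exact: sqnorm_ge0.
Qed.

Lemma energyZ (c : R) f : cmeasurable_fun setT f ->
  energy (fun t => c%:C * f t) = ((c ^+ 2)%:E * energy f)%E.
Proof.
move=> /measurable_sqnorm mf; rewrite /energy.
under eq_integral do rewrite sqnormM sqnorm_real EFinM.
rewrite ge0_integralZl_EFin ?sqr_ge0//.
- by move=> t _; rewrite lee_fin sqnorm_ge0.
- exact/measurable_EFinP.
Qed.

Definition ctruncated_continuous (a b : R) V : Prop :=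
  truncated_continuous a b (fun w => Re (V w)) /\
  truncated_continuous a b (fun w => Im (V w)).

Definition fourier_integral V (s : R) : R[i] :=
  cintegral setT (fun w => V w * cexp (0 +i* (w * s))).

Lemma Re_fourier_integral V s :
  mu.-integrable setT (EFin \o (fun w => Re (V w))) ->
  mu.-integrable setT (EFin \o (fun w => Im (V w))) ->
  Re (fourier_integral V s) =
  fourier_cos (fun w => Re (V w)) s - fourier_sin (fun w => Im (V w)) s.
Proof.
move=> iX iY; rewrite /= -RintegralB//; last 2 first.
- exact: integrable_mul_cos.
- exact: integrable_mul_sin.
by apply: eq_Rintegral => w _; case: (V w) => x y /=; rewrite expR0 !mul1r.
Qed.

Lemma Im_fourier_integral V s :
  mu.-integrable setT (EFin \o (fun w => Re (V w))) ->
  mu.-integrable setT (EFin \o (fun w => Im (V w))) ->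
  Im (fourier_integral V s) =
  fourier_sin (fun w => Re (V w)) s + fourier_cos (fun w => Im (V w)) s.
Proof.
move=> iX iY; rewrite /= -RintegralD//; last 2 first.
- exact: integrable_mul_sin.
- exact: integrable_mul_cos.
apply: eq_Rintegral => w _; case: (V w) => x y /=; rewrite expR0 !mul1r; ring.
Qed.

Lemma fourier_cosN (A : R -> R) s : fourier_cos A (- s) = fourier_cos A s.
Proof. by apply: eq_Rintegral => w _; rewrite mulrN cosN. Qed.

Lemma fourier_sinN (A : R -> R) s :
  mu.-integrable setT (EFin \o A) -> fourier_sin A (- s) = - fourier_sin A s.
Proof.
move=> iA; rewrite -[RHS]mulN1r -RintegralZl//; last first.
  exact: integrable_mul_sin.
by apply: eq_Rintegral => w _; rewrite mulrN sinN; ring.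
Qed.

Lemma ctruncated_continuous_integrable a b V : ctruncated_continuous a b V ->
  mu.-integrable setT (EFin \o (fun w => Re (V w))) /\
  mu.-integrable setT (EFin \o (fun w => Im (V w))).
Proof.
by move=> [tX tY]; split; apply: truncated_continuous_integrable; [exact: tX|exact: tY].
Qed.

Lemma fourier_integral_continuous V :
  mu.-integrable setT (EFin \o (fun w => Re (V w))) ->
  mu.-integrable setT (EFin \o (fun w => Im (V w))) ->
  continuous (fun s => Re (fourier_integral V s)) /\
  continuous (fun s => Im (fourier_integral V s)).
Proof.
move=> iX iY; split.
  rewrite (_ : (fun s => _) = (fun s => fourier_cos (fun w => Re (V w)) s -
    fourier_sin (fun w => Im (V w)) s)); last first.
    by apply/funext => s; rewrite Re_fourier_integral.
  by move=> s; apply: cvgB; [exact: continuous_fourier_cos|exact: continuous_fourier_sin].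
rewrite (_ : (fun s => _) = (fun s => fourier_sin (fun w => Re (V w)) s +
  fourier_cos (fun w => Im (V w)) s)); last first.
  by apply/funext => s; rewrite Im_fourier_integral.
by move=> s; apply: cvgD; [exact: continuous_fourier_sin|exact: continuous_fourier_cos].
Qed.

Lemma fourier_integral_measurable V :
  mu.-integrable setT (EFin \o (fun w => Re (V w))) ->
  mu.-integrable setT (EFin \o (fun w => Im (V w))) ->
  cmeasurable_fun setT (fourier_integral V).
Proof.
move=> iX iY; have [cX cY] := fourier_integral_continuous iX iY.
by split; exact: continuous_measurable_fun.
Qed.

Lemma ctruncated_energy a b V : ctruncated_continuous a b V ->
  [/\ mu.-integrable setT (EFin \o (fun w => Re (V w) ^+ 2)),
      mu.-integrable setT (EFin \o (fun w => Im (V w) ^+ 2)) &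
  energy V = (\int[mu]_w Re (V w) ^+ 2 + \int[mu]_w Im (V w) ^+ 2)%:E].
Proof.
move=> [tX tY].
have iX := truncated_continuous_integrable tX.
have iY := truncated_continuous_integrable tY.
have [_ [M XM] _ _] := tX; have [_ [N YN] _ _] := tY.
have iX2 := integrable_sqr_bounded iX XM.
have iY2 := integrable_sqr_bounded iY YN.
split=> //; rewrite -RintegralD// /Rintegral fineK//.
have := integrableD measurableT iX2 iY2.
by move/(integrable_fin_num measurableT).
Qed.

(* The cross terms of the real and imaginary parts are odd in t, and cancel
   after averaging over t and -t. *)
Lemma energy_fourier_integral a b V : ctruncated_continuous a b V ->
  energy (fourier_integral V) = ((2 * pi)%:E * energy V)%E.
Proof.
move=> tV; have [iX iY] := ctruncated_continuous_integrable tV.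
have [_ _ ->] := ctruncated_energy tV.
have mF := fourier_integral_measurable iX iY.
have mF2 := measurable_sqnorm mF.
case: tV => tX tY.
set X := fun w => Re (V w) in iX tX *; set Y := fun w => Im (V w) in iY tY *.
pose h t := sqnorm (fourier_integral V t).
pose q (A : R -> R) t := fourier_cos A t ^+ 2 + fourier_sin A t ^+ 2.
have q0 A t : 0 <= q A t by rewrite addr_ge0 ?sqr_ge0.
have mq A : mu.-integrable setT (EFin \o A) -> measurable_fun setT (q A).
  move=> iA; apply: measurable_funD; apply: measurable_funX;
    apply: continuous_measurable_fun.
    exact: continuous_fourier_cos.
  exact: continuous_fourier_sin.
have hE t : h t + h (- t) = 2 * q X t + 2 * q Y t.
  rewrite /h /sqnorm !Re_fourier_integral// !Im_fourier_integral//.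
  rewrite !fourier_cosN !fourier_sinN// -/X -/Y /q; ring.
have hh : (energy (fourier_integral V) + energy (fourier_integral V) =
    (2 * (2 * pi * (\int[mu]_w X w ^+ 2 + \int[mu]_w Y w ^+ 2)))%:E)%E.
  rewrite -[X in (_ + X)%E](energy_oppr mF) /energy -ge0_integralD//; first last.
  - apply/measurable_EFinP.
    exact: (measurableT_comp mF2 (@oppr_measurable R setT)).
  - by move=> t _; rewrite lee_fin sqnorm_ge0.
  - exact/measurable_EFinP.
  - by move=> t _; rewrite lee_fin sqnorm_ge0.
  under eq_integral do rewrite -EFinD hE EFinD !EFinM.
  rewrite ge0_integralD//; first last.
  - by apply/measurable_EFinP; exact: measurable_funM (measurable_cst _) (mq _ iY).
  - by move=> t _; rewrite lee_fin mulr_ge0.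
  - by apply/measurable_EFinP; exact: measurable_funM (measurable_cst _) (mq _ iX).
  - by move=> t _; rewrite lee_fin mulr_ge0.
  rewrite !ge0_integralZl_EFin//; first last.
  - by apply/measurable_EFinP; exact: mq.
  - by move=> t _; rewrite lee_fin.
  - by apply/measurable_EFinP; exact: mq.
  - by move=> t _; rewrite lee_fin.
  rewrite (integral_fourier_sqr tX) (integral_fourier_sqr tY) -!EFinM -EFinD.
  by congr EFin; ring.
have := energy_ge0 (fourier_integral V); move: hh.
case: (energy _) => [r| |]//= [rr] _; rewrite -EFinM; congr EFin; lra.
Qed.

Definition inv_sqrt_twopi : R := (Num.sqrt (2 * pi))^-1.

Definition inv_fourier V (t : R) : R[i] :=
  inv_sqrt_twopi%:C * fourier_integral V t.

Lemma twopi_gt0 : 0 < 2 * pi :> R.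
Proof. by rewrite mulr_gt0// pi_gt0. Qed.

Lemma sqr_invsqrt_twopi : inv_sqrt_twopi ^+ 2 * (2 * pi) = 1.
Proof.
by rewrite /inv_sqrt_twopi exprVn sqr_sqrtr ?(ltW twopi_gt0)// mulVf// gt_eqF// twopi_gt0.
Qed.

Lemma energy_inv_fourier a b V : ctruncated_continuous a b V ->
  energy (inv_fourier V) = energy V.
Proof.
move=> tV; have [iX iY] := ctruncated_continuous_integrable tV.
rewrite energyZ; last exact: fourier_integral_measurable.
rewrite (energy_fourier_integral tV) muleA -EFinM sqr_invsqrt_twopi.
by rewrite mul1e.
Qed.

Lemma truncated_continuous_if (a b M : R) (A : R -> R) :
  measurable_fun setT A -> (forall x, x \in `[a, b] -> `|A x| <= M) ->
  (forall x, x \in `]a, b[ -> {for x, continuous A}) ->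
  truncated_continuous a b (fun x => if x \in `[a, b] then A x else 0).
Proof.
move=> mA AM cA; split.
- rewrite (_ : (fun x => _) = (fun x => A x * \1_(`[a, b]%classic) x)).
    exact: measurable_funM.
  apply/funext => x; rewrite indicE mem_setE.
  by case: (x \in `[a, b]); rewrite ?mulr1 ?mulr0.
- exists `|M| => x; case: ifPn => [/AM xM|_]; last by rewrite normr0.
  by rewrite (le_trans xM)// ler_norm.
- by move=> x /negbTE ->.
- move=> x xa xb; have [xab|xab] := boolP (x \in `[a, b]).
    have xab' : x \in `]a, b[.
      by move: xab; rewrite !in_itv/= !lt_neqAle xb (eq_sym a) xa.
    rewrite /prop_for /continuous_at xab.
    apply: cvg_trans (cA _ xab'); apply: near_eq_cvg.
    near=> y; suff -> : y \in `[a, b] by [].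
    by apply: subset_itv_oo_cc; near: y; exact: near_in_itvoo.
  rewrite /prop_for /continuous_at (negbTE xab).
  apply: cvg_near_cst.
  move: xab; rewrite in_itv/= negb_and -!ltNge => /orP[xa'|bx].
    near=> y; rewrite in_itv/= leNgt (_ : y < a)//.
    by near: y; exact: lt_nbhsl.
  near=> y; rewrite in_itv/= [y <= b]leNgt (_ : b < y) ?andbF//.
  by near: y; exact: lt_nbhsr.
Unshelve. all: by end_near. Qed.

(** The multiplication formula: the kernel cos (x t) is symmetric in x and t. With its sine analogue
    it moves the transform from the windowed function onto [V] in the cross term of the inversion
    error. *)
Lemma Rintegral_fourier_cosC (A B : R -> R) :
  mu.-integrable setT (EFin \o A) -> mu.-integrable setT (EFin \o B) ->
  \int[mu]_x (A x * fourier_cos B x) = \int[mu]_t (B t * fourier_cos A t).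
Proof.
move=> iA iB.
rewrite (Rintegral_Fubini_bounded iA iB (K := fun x y => cos (y * x)) (C := 1)).
- by apply: eq_Rintegral => t _; congr (_ * _); apply: eq_Rintegral => x _;
    rewrite (mulrC t).
- apply: (@measurableT_comp _ _ _ _ _ _ (@cos R)).
    by apply: continuous_measurable_fun; exact: continuous_cos.
  by apply: measurable_funM.
- by move=> x y; exact: normr_cos_le1.
Qed.

Lemma Rintegral_fourier_sinC (A B : R -> R) :
  mu.-integrable setT (EFin \o A) -> mu.-integrable setT (EFin \o B) ->
  \int[mu]_x (A x * fourier_sin B x) = \int[mu]_t (B t * fourier_sin A t).
Proof.
move=> iA iB.
rewrite (Rintegral_Fubini_bounded iA iB (K := fun x y => sin (y * x)) (C := 1)).
- by apply: eq_Rintegral => t _; congr (_ * _); apply: eq_Rintegral => x _;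
    rewrite (mulrC t).
- apply: (@measurableT_comp _ _ _ _ _ _ (@sin R)).
    by apply: continuous_measurable_fun; exact: continuous_sin.
  by apply: measurable_funM.
- by move=> x y; exact: normr_sin_le1.
Qed.

Definition window (n : nat) v (t : R) : R[i] :=
  if t \in `[- n%:R, n%:R] then v t else 0.

Lemma Re_inv_fourier V t : Re (inv_fourier V t) =
  inv_sqrt_twopi * Re (fourier_integral V t).
Proof. by rewrite /inv_fourier; case: fourier_integral => a b /=; ring. Qed.

Lemma Im_inv_fourier V t : Im (inv_fourier V t) =
  inv_sqrt_twopi * Im (fourier_integral V t).
Proof. by rewrite /inv_fourier; case: fourier_integral => a b /=; ring. Qed.

Lemma inv_fourier_measurable V :
  mu.-integrable setT (EFin \o (fun w => Re (V w))) ->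
  mu.-integrable setT (EFin \o (fun w => Im (V w))) ->
  cmeasurable_fun setT (inv_fourier V).
Proof.
move=> iX iY; apply: (@cmeasurableM _ _ _ (fun=> inv_sqrt_twopi%:C)).
  by split; exact: measurable_cst.
exact: fourier_integral_measurable.
Qed.

(** The inverse transform of an integrable function is continuous and bounded, so its truncation
    falls back into the class for which Plancherel's identity is proved. This allows the identity to
    be applied a second time. *)
Lemma window_inv_fourier n V :
  mu.-integrable setT (EFin \o (fun w => Re (V w))) ->
  mu.-integrable setT (EFin \o (fun w => Im (V w))) ->
  ctruncated_continuous (- n%:R) n%:R (window n (inv_fourier V)).
Proof.
move=> iX iY; have [cX cY] := fourier_integral_continuous iX iY.
have [mX mY] := inv_fourier_measurable iX iY.
set M := \int[mu]_x `|Re (V x)| + \int[mu]_x `|Im (V x)|.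
pose c := inv_sqrt_twopi.
have c0 : 0 <= c by rewrite invr_ge0 sqrtr_ge0.
split.
  rewrite (_ : (fun w => _) = (fun t => if t \in `[- n%:R, n%:R] then
      Re (inv_fourier V t) else 0)); last first.
    by apply/funext => t; rewrite /window; case: ifPn.
  apply: (@truncated_continuous_if _ _ (c * M)) => //.
    move=> t _; rewrite Re_inv_fourier normrM (ger0_norm c0) ler_wpM2l//.
    rewrite Re_fourier_integral// (le_trans (ler_normB _ _))// lerD//.
      exact: normr_fourier_cos.
    exact: normr_fourier_sin.
  move=> t _; rewrite (_ : (fun t => _) = (fun t => c * Re (fourier_integral V t))).
    by apply: cvgMl_tmp; exact: cX.
  by apply/funext => s; exact: Re_inv_fourier.
rewrite (_ : (fun w => _) = (fun t => if t \in `[- n%:R, n%:R] then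
    Im (inv_fourier V t) else 0)); last first.
  by apply/funext => t; rewrite /window; case: ifPn.
apply: (@truncated_continuous_if _ _ (c * M)) => //.
  move=> t _; rewrite Im_inv_fourier normrM (ger0_norm c0) ler_wpM2l//.
  rewrite Im_fourier_integral// (le_trans (ler_normD _ _))// lerD//.
    exact: normr_fourier_sin.
  exact: normr_fourier_cos.
move=> t _; rewrite (_ : (fun t => _) = (fun t => c * Im (fourier_integral V t))).
  by apply: cvgMl_tmp; exact: cY.
by apply/funext => s; exact: Im_inv_fourier.
Qed.

(** Up to the reflection w -> - w the direct and inverse transforms are the same integral, so the
    results on [inv_fourier] cover truncated transforms too. *)
Lemma truncated_fourierE n v w :
  truncated_fourier n v w = inv_fourier (window n v) (- w).
Proof.
rewrite /truncated_fourier /inv_fourier /fourier_integral /cintegral.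
congr (_ * (_ +i* _)).
  rewrite Rintegral_mkcond; apply: eq_Rintegral => t _.
  rewrite /patch /window mem_setE; case: ifPn => _; last by rewrite mul0r.
  by rewrite mulrN (mulrC t).
rewrite Rintegral_mkcond; apply: eq_Rintegral => t _.
rewrite /patch /window mem_setE; case: ifPn => _; last by rewrite mul0r.
by rewrite mulrN (mulrC t).
Qed.

Lemma truncated_fourier_measurable_window n v :
  mu.-integrable setT (EFin \o (fun t => Re (window n v t))) ->
  mu.-integrable setT (EFin \o (fun t => Im (window n v t))) ->
  cmeasurable_fun setT (truncated_fourier n v).
Proof.
move=> iP iQ; have [mr mi] := inv_fourier_measurable iP iQ.
have E : truncated_fourier n v = (fun w => inv_fourier (window n v) (- w)).
  by apply/funext => w; rewrite truncated_fourierE.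
by rewrite E; split; [exact: (measurableT_comp mr (@oppr_measurable R setT))|
  exact: (measurableT_comp mi (@oppr_measurable R setT))].
Qed.

(* Expanding the square, the cross term is twice the energy of the windowed
   inverse transform (Fubini), and so is, up to sign, the energy of the
   truncated transform (Plancherel). *)
Lemma energy_inversion_error a b V n : ctruncated_continuous a b V ->
  energy (V \- truncated_fourier n (inv_fourier V)) =
  (energy V - energy (window n (inv_fourier V)))%E.
Proof.
move=> tV; have [iX iY] := ctruncated_continuous_integrable tV.
have [iX2 iY2 EV] := ctruncated_energy tV.
set v := inv_fourier V; pose c := inv_sqrt_twopi.
have tW : ctruncated_continuous (- n%:R) n%:R (window n v).
  exact: window_inv_fourier.
have [iP iQ] := ctruncated_continuous_integrable tW.
have [iP2 iQ2 EW] := ctruncated_energy tW.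
pose X w := Re (V w); pose Y w := Im (V w).
pose P t := Re (window n v t); pose Q t := Im (window n v t).
pose S w := c * (fourier_cos P w + fourier_sin Q w).
pose U w := c * (fourier_cos Q w - fourier_sin P w).
have TS w : Re (truncated_fourier n v w) = S w.
  rewrite truncated_fourierE Re_inv_fourier Re_fourier_integral//.
  by rewrite fourier_cosN fourier_sinN// opprK.
have TU w : Im (truncated_fourier n v w) = U w.
  rewrite truncated_fourierE Im_inv_fourier Im_fourier_integral//.
  by rewrite fourier_cosN fourier_sinN// addrC.
have Pp t : P t = (t \in `[- n%:R, n%:R])%:R * (c * (fourier_cos X t - fourier_sin Y t)).
  rewrite /P /window; case: ifPn => _; rewrite ?mul0r// mul1r.
  by rewrite /v Re_inv_fourier Re_fourier_integral.
have Qq t : Q t = (t \in `[- n%:R, n%:R])%:R * (c * (fourier_sin X t + fourier_cos Y t)).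
  rewrite /Q /window; case: ifPn => _; rewrite ?mul0r// mul1r.
  by rewrite /v Im_inv_fourier Im_fourier_integral.
have mT : cmeasurable_fun setT (truncated_fourier n v).
  exact: truncated_fourier_measurable_window.
have ET : energy (truncated_fourier n v) = energy (window n v).
  rewrite -(energy_inv_fourier tW) -(energy_oppr (inv_fourier_measurable iP iQ)).
  by rewrite /energy; apply: eq_integral => w _; rewrite truncated_fourierE.
have ib (A B : R -> R) : mu.-integrable setT (EFin \o A) -> mu.-integrable setT (EFin \o B) ->
    mu.-integrable setT (EFin \o (fun x => A x * fourier_cos B x)) /\
    mu.-integrable setT (EFin \o (fun x => A x * fourier_sin B x)).
  move=> iA iB; split; apply: (@integrableM_bounded _ _ _ _
    (\int[mu]_x `|B x|)) => //.
  - by apply: continuous_measurable_fun; exact: continuous_fourier_cos.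
  - by move=> x _; exact: normr_fourier_cos.
  - by apply: continuous_measurable_fun; exact: continuous_fourier_sin.
  - by move=> x _; exact: normr_fourier_sin.
have [iXPc iXPs] := ib X P iX iP; have [iXQc iXQs] := ib X Q iX iQ.
have [iYPc iYPs] := ib Y P iY iP; have [iYQc iYQs] := ib Y Q iY iQ.
have [iPXc iPXs] := ib P X iP iX; have [iQXc iQXs] := ib Q X iQ iX.
have [iPYc iPYs] := ib P Y iP iY; have [iQYc iQYs] := ib Q Y iQ iY.
have iZ (r : R) (A : R -> R) : mu.-integrable setT (EFin \o A) ->
    mu.-integrable setT (EFin \o (fun x => r * A x)).
  move=> iA; rewrite /comp; under eq_fun do rewrite EFinM.
  exact: integrableZl.
have iD (A B : R -> R) : mu.-integrable setT (EFin \o A) -> mu.-integrable setT (EFin \o B) ->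
    mu.-integrable setT (EFin \o (fun x => A x + B x)).
  by move=> iA iB; have := integrableD measurableT iA iB.
have iB (A B : R -> R) : mu.-integrable setT (EFin \o A) -> mu.-integrable setT (EFin \o B) ->
    mu.-integrable setT (EFin \o (fun x => A x - B x)).
  by move=> iA' iB'; have := integrableB measurableT iA' iB'.
pose C1 w := (X w * fourier_cos P w + X w * fourier_sin Q w) +
  (Y w * fourier_cos Q w - Y w * fourier_sin P w).
have iXC := iD _ _ iXPc iXQs; have iYC := iB _ _ iYQc iYPs.
have iC1 : mu.-integrable setT (EFin \o C1) := iD _ _ iXC iYC.
have crossE w : X w * S w + Y w * U w = c * C1 w by rewrite /S /U /C1; ring.
have intC1 : c * \int[mu]_w C1 w = \int[mu]_t P t ^+ 2 + \int[mu]_t Q t ^+ 2.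
  rewrite (RintegralD measurableT iXC iYC) (RintegralD measurableT iXPc iXQs).
  rewrite (RintegralB measurableT iYQc iYPs).
  rewrite (Rintegral_fourier_cosC iX iP) (Rintegral_fourier_sinC iX iQ).
  rewrite (Rintegral_fourier_cosC iY iQ) (Rintegral_fourier_sinC iY iP).
  have -> : \int[mu]_t P t ^+ 2 =
      c * (\int[mu]_t (P t * fourier_cos X t) - \int[mu]_t (P t * fourier_sin Y t)).
    rewrite -(RintegralB measurableT iPXc iPYs).
    rewrite -(RintegralZl _ measurableT (iB _ _ iPXc iPYs)).
    apply: eq_Rintegral => t _; rewrite expr2 {2}Pp.
    have : P t = (t \in `[- n%:R, n%:R])%:R * P t.
      by rewrite /P /window; case: ifPn; rewrite ?mul1r ?mul0r.
    by case: (t \in _) => /= H; [|rewrite H]; ring.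
  have -> : \int[mu]_t Q t ^+ 2 =
      c * (\int[mu]_t (Q t * fourier_sin X t) + \int[mu]_t (Q t * fourier_cos Y t)).
    rewrite -(RintegralD measurableT iQXs iQYc).
    rewrite -(RintegralZl _ measurableT (iD _ _ iQXs iQYc)).
    apply: eq_Rintegral => t _; rewrite expr2 {2}Qq.
    have : Q t = (t \in `[- n%:R, n%:R])%:R * Q t.
      by rewrite /Q /window; case: ifPn; rewrite ?mul1r ?mul0r.
    by case: (t \in _) => /= H; [|rewrite H]; ring.
  move: (Rintegral _ _ _) (Rintegral _ _ _) (Rintegral _ _ _) (Rintegral _ _ _).
  by move=> r1 r2 r3 r4; ring.
have iT2 : mu.-integrable setT (EFin \o (fun w => sqnorm (truncated_fourier n v w))).
  apply/integrableP; split; first by apply/measurable_EFinP; exact: measurable_sqnorm.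
  under eq_integral do rewrite /= ger0_norm ?sqnorm_ge0//.
  by rewrite -[X in (X < _)%E]/(energy (truncated_fourier n v)) ET EW ltry.
have iV2 : mu.-integrable setT (EFin \o (fun w => sqnorm (V w))).
  exact: (iD _ _ iX2 iY2).
have -> : energy (V \- truncated_fourier n v) =
    (\int[mu]_w ((sqnorm (V w) + sqnorm (truncated_fourier n v w)) -
      (2 * c) * C1 w)%:E)%E.
  apply: eq_integral => w _; congr EFin.
  by rewrite -mulrA -crossE -TS -TU -sqnormB.
have iC2 := iZ (2 * c) _ iC1.
rewrite integralB_EFin//; last exact: (iD).
rewrite integralD_EFin// -/(energy V) -/(energy (truncated_fourier n v)) ET.
have -> : (\int[mu]_w ((2 * c) * C1 w)%:E = 2%:E * energy (window n v))%E.
  rewrite EW -intC1 /Rintegral -EFinM.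
  under [LHS]eq_integral do rewrite EFinM.
  rewrite [LHS](integralZl measurableT iC1 (2 * c)) mulrA [RHS]EFinM fineK//.
  exact: integrable_fin_num iC1.
by rewrite EV EW -EFinM -!EFinD; congr EFin; ring.
Qed.

End L2energy.

(** * Fourier pairs in L2: inversion, additivity and uniqueness *)

Section FourierL2.
Context {R : realType}.
Local Notation mu := (@lebesgue_measure R).
Local Notation Re := complex.Re.
Local Notation Im := complex.Im.
Implicit Types (f g u v V W : R -> R[i]).

Definition cintegrable_line V : Prop :=
  mu.-integrable setT (EFin \o (fun w => Re (V w))) /\
  mu.-integrable setT (EFin \o (fun w => Im (V w))).

Lemma window_measurable n v : cmeasurable_fun setT v ->
  cmeasurable_fun setT (window n v).
Proof.
move=> mv; pose I (t : R) : R[i] := (\1_(`[- n%:R, n%:R]%classic) t)%:C.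
have mI : cmeasurable_fun setT I by split=> /=; [exact: measurable_indic|exact: measurable_cst].
have := cmeasurableM mI mv; rewrite (_ : I \* v = window n v)//.
apply/funext => t; rewrite /I /window /= indicE mem_setE.
by case: (t \in _) => /=; rewrite ?mul1r// mul0r.
Qed.

Lemma energy_window_cvg v : cmeasurable_fun setT v ->
  energy (window n v) @[n --> \oo] --> energy v.
Proof.
move=> mv.
rewrite (_ : energy v =
    (\int[mu]_t limn (fun n => (sqnorm (window n v t))%:E))%E).
  apply: cvg_monotone_convergence => //.
  - move=> n; apply/measurable_EFinP.
    by apply: measurable_sqnorm; exact: window_measurable.
  - by move=> n t _; rewrite lee_fin sqnorm_ge0.
  - move=> t _ m n mn; rewrite lee_fin /window.
    case: ifPn => [tm|_]; last by rewrite /sqnorm /= expr0n addr0 sqnorm_ge0.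
    rewrite (_ : t \in `[- n%:R, n%:R])//.
    apply: subitvP tm; rewrite subitvE !bnd_simp lerN2 !ler_nat mn//.
apply: eq_integral => t _; apply/esym/cvg_lim => //; apply: cvg_near_cst.
near=> n; rewrite /window (_ : t \in `[- n%:R, n%:R])//.
rewrite in_itv/= -ler_norml.
by near: n; exact: nbhs_infty_ger.
Unshelve. all: by end_near. Qed.

Lemma inv_fourier_in_L2 a b V : ctruncated_continuous a b V ->
  in_L2 V /\ in_L2 (inv_fourier V).
Proof.
move=> tV; have [iX iY] := ctruncated_continuous_integrable tV.
have [_ _ EV] := ctruncated_energy tV.
split; split.
- by case: tV => [[mX _ _ _] [mY _ _ _]].
- by rewrite L2norm_lty EV ltry.
- exact: inv_fourier_measurable.
- by rewrite L2norm_lty (energy_inv_fourier tV) EV ltry.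
Qed.

Lemma L2norm_inv_fourier a b V : ctruncated_continuous a b V ->
  L2norm (inv_fourier V) = L2norm V.
Proof. by move=> tV; rewrite !L2normE (energy_inv_fourier tV). Qed.

(** The squared truncation error is the energy of [V] minus that of the windowed inverse transform.
    The latter increases to the energy of the whole inverse transform, which Plancherel's identity
    equates with that of [V]. *)
Lemma is_fourier_inv_fourier a b V : ctruncated_continuous a b V ->
  is_fourier (inv_fourier V) V.
Proof.
move=> tV; have [LV Lv] := inv_fourier_in_L2 tV; split => //.
apply: L2norm_cvg0; under eq_fun do rewrite (energy_inversion_error _ tV).
have [_ _ EV] := ctruncated_energy tV.
have fE : energy V \is a fin_num by rewrite EV.
rewrite -(subee fE); apply: cvgeB; first exact: fin_num_adde_defr.
  exact: cvg_cst.
by rewrite -(energy_inv_fourier tV); apply: energy_window_cvg; case: Lv.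
Qed.

Lemma window_cintegrable n v : in_L2 v -> cintegrable_line (window n v).
Proof.
move=> [mv]; rewrite L2norm_lty => ev.
have [mr mi] := window_measurable n mv.
(* Square integrability gives integrability on a bounded window through |x| <= 1 + |x|^2; [g] is the
   resulting dominating function. *)
pose g (t : R) : R := \1_(`[- n%:R, n%:R]%classic) t + sqnorm (v t).
have ig : mu.-integrable setT (EFin \o g).
  have iI : mu.-integrable setT (EFin \o (\1_(`[- n%:R, n%:R]%classic) : R -> R)).
    exact: integrable_indic_itv.
  have iv : mu.-integrable setT (EFin \o (fun t => sqnorm (v t))).
    apply/integrableP; split; first by apply/measurable_EFinP; exact: measurable_sqnorm.
    by under eq_integral do rewrite /= ger0_norm ?sqnorm_ge0//.
  by have := integrableD measurableT iI iv.
have bound (x y : R) : `|x| <= 1 + (x ^+ 2 + y ^+ 2).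
  have := sqr_ge0 (`|x| - 1); have := sqr_ge0 y.
  rewrite -(real_normK (num_real x)); move: (`|x|) (normr_ge0 x) => z z0.
  by move=> y0; nra.
split; apply: le_integrable ig => //; first exact/measurable_EFinP.
- move=> t _; rewrite lee_fin /g /window indicE mem_setE; case: ifPn => _ /=.
    by rewrite (le_trans (bound _ (Im (v t))))// ler_norm.
  by rewrite normr0.
- exact/measurable_EFinP.
- move=> t _; rewrite lee_fin /g /window indicE mem_setE; case: ifPn => _ /=.
    by rewrite (le_trans (bound _ (Re (v t))))// (addrC (Im _ ^+ 2)) ler_norm.
  by rewrite normr0.
Qed.

Lemma fourier_cosDZ (A B : R -> R) (c t : R) :
  mu.-integrable setT (EFin \o A) -> mu.-integrable setT (EFin \o B) ->
  fourier_cos (fun x => A x + c * B x) t = fourier_cos A t + c * fourier_cos B t.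
Proof.
move=> /(integrable_mul_cos t) iA /(integrable_mul_cos t) iB.
rewrite -(RintegralZl _ measurableT iB).
rewrite -(RintegralD measurableT iA (_ : mu.-integrable setT
  (EFin \o (fun x => c * (B x * cos (x * t)))))).
  by apply: eq_Rintegral => x _; ring.
by rewrite /comp; under eq_fun do rewrite EFinM; exact: integrableZl.
Qed.

Lemma fourier_sinDZ (A B : R -> R) (c t : R) :
  mu.-integrable setT (EFin \o A) -> mu.-integrable setT (EFin \o B) ->
  fourier_sin (fun x => A x + c * B x) t = fourier_sin A t + c * fourier_sin B t.
Proof.
move=> /(integrable_mul_sin t) iA /(integrable_mul_sin t) iB.
rewrite -(RintegralZl _ measurableT iB).
rewrite -(RintegralD measurableT iA (_ : mu.-integrable setT
  (EFin \o (fun x => c * (B x * sin (x * t)))))).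
  by apply: eq_Rintegral => x _; ring.
by rewrite /comp; under eq_fun do rewrite EFinM; exact: integrableZl.
Qed.

(** A real scalar treats sum and difference at once, through c = 1 and c = -1. *)
Lemma inv_fourierDZ (c : R) V W : cintegrable_line V -> cintegrable_line W ->
  inv_fourier (fun x => V x + c%:C * W x) =
  (fun t => inv_fourier V t + c%:C * inv_fourier W t).
Proof.
move=> [iX iY] [iP iQ].
have ReE : (fun w => Re (V w + c%:C * W w)) = (fun w => Re (V w) + c * Re (W w)).
  by apply/funext => w; case: (V w) => x y; case: (W w) => p q /=; ring.
have ImE : (fun w => Im (V w + c%:C * W w)) = (fun w => Im (V w) + c * Im (W w)).
  by apply/funext => w; case: (V w) => x y; case: (W w) => p q /=; ring.
have iDZ (A B : R -> R) : mu.-integrable setT (EFin \o A) ->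
    mu.-integrable setT (EFin \o B) ->
    mu.-integrable setT (EFin \o (fun x => A x + c * B x)).
  move=> iA iB.
  have icB : mu.-integrable setT (EFin \o (fun x => c * B x)).
    by rewrite /comp; under eq_fun do rewrite EFinM; exact: integrableZl.
  by have := integrableD measurableT iA icB.
have iRe : mu.-integrable setT (EFin \o (fun w => Re (V w + c%:C * W w))).
  by rewrite ReE; exact: iDZ.
have iIm : mu.-integrable setT (EFin \o (fun w => Im (V w + c%:C * W w))).
  by rewrite ImE; exact: iDZ.
have ReM (r : R) (z : R[i]) : Re (r%:C * z) = r * Re z by case: z => x y /=; ring.
have ImM (r : R) (z : R[i]) : Im (r%:C * z) = r * Im z by case: z => x y /=; ring.
have ReD (z1 z2 : R[i]) : Re (z1 + z2) = Re z1 + Re z2 by case: z1; case: z2.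
have ImD (z1 z2 : R[i]) : Im (z1 + z2) = Im z1 + Im z2 by case: z1; case: z2.
apply/funext => t; apply/eqP; rewrite eq_complex; apply/andP; split; apply/eqP.
  rewrite ReD [Re (c%:C * _)]ReM !Re_inv_fourier !Re_fourier_integral//.
  by rewrite ReE ImE fourier_cosDZ// fourier_sinDZ//; ring.
rewrite ImD [Im (c%:C * _)]ImM !Im_inv_fourier !Im_fourier_integral//.
by rewrite ReE ImE fourier_cosDZ// fourier_sinDZ//; ring.
Qed.

Lemma inv_fourierD V W : cintegrable_line V -> cintegrable_line W ->
  inv_fourier (V \+ W) = inv_fourier V \+ inv_fourier W.
Proof.
move=> iV iW; have := inv_fourierDZ 1 iV iW.
under [X in inv_fourier X = _]eq_fun do rewrite mul1r.
by under [X in _ = X]eq_fun do rewrite mul1r.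
Qed.

Lemma inv_fourierB V W : cintegrable_line V -> cintegrable_line W ->
  inv_fourier (V \- W) = inv_fourier V \- inv_fourier W.
Proof.
move=> iV iW; have := inv_fourierDZ (-1) iV iW; rewrite rmorphN1.
under [X in inv_fourier X = _]eq_fun do rewrite mulN1r.
by under [X in _ = X]eq_fun do rewrite mulN1r.
Qed.

Lemma truncated_fourierD n v u : in_L2 v -> in_L2 u ->
  truncated_fourier n (v \+ u) = truncated_fourier n v \+ truncated_fourier n u.
Proof.
move=> Lv Lu; apply/funext => s /=; rewrite !truncated_fourierE.
have -> : window n (v \+ u) = window n v \+ window n u.
  by apply/funext => t; rewrite /window /=; case: ifPn => _ //; rewrite addr0.
by rewrite inv_fourierD//; exact: window_cintegrable.
Qed.

Lemma truncated_fourier_measurable n v : in_L2 v ->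
  cmeasurable_fun setT (truncated_fourier n v).
Proof.
by move=> /(window_cintegrable n)[]; exact: truncated_fourier_measurable_window.
Qed.

Lemma L2norm_subC f g : L2norm (f \- g) = L2norm (g \- f).
Proof.
rewrite !L2normE; congr (_ `^ _)%E; apply: eq_integral => t _ /=.
congr EFin; rewrite /sqnorm; case: (f t) => a b; case: (g t) => c d /=; ring.
Qed.

Lemma in_L2D f g : in_L2 f -> in_L2 g -> in_L2 (f \+ g).
Proof.
move=> [mf Lf] [mg Lg]; split; first exact: cmeasurableD.
by apply: le_lt_trans (L2normD mf mg) _; rewrite lte_add_pinfty.
Qed.

Lemma L2norm_triangle f g u : cmeasurable_fun setT f -> cmeasurable_fun setT g ->
  cmeasurable_fun setT u -> (L2norm (f \- u)%R <= L2norm (f \- g)%R + L2norm (g \- u)%R)%E.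
Proof.
move=> mf mg mu0.
have -> : f \- u = (f \- g) \+ (g \- u).
  by apply/funext => t /=; rewrite addrA subrK.
by apply: L2normD; exact: cmeasurableB.
Qed.

Lemma squeeze_cvge0D (T : Type) (F : set_system T) {FF : Filter F}
    (x a b : T -> \bar R) :
  (forall t, 0 <= x t)%E -> (\forall t \near F, x t <= a t + b t)%E ->
  a t @[t --> F] --> 0%E -> b t @[t --> F] --> 0%E -> x t @[t --> F] --> 0%E.
Proof.
move=> x0 xab a0 b0.
apply: (@squeeze_cvge _ _ _ _ (cst 0%E) _ (fun t => a t + b t)%E).
- by apply: filterS xab => t; rewrite x0.
- exact: cvg_cst.
- by rewrite -[X in _ --> X]add0e; apply: cvgeD.
Qed.

Lemma is_fourierD v u V W : is_fourier v V -> is_fourier u W ->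
  is_fourier (v \+ u) (V \+ W).
Proof.
move=> [Lv LV cV] [Lu LW cW]; split; [exact: in_L2D|exact: in_L2D|].
apply: squeeze_cvge0D cV cW ; [by move=> n; exact: L2norm_ge0|apply: nearW => n].
rewrite truncated_fourierD//.
have -> : (V \+ W) \- (truncated_fourier n v \+ truncated_fourier n u) =
    (V \- truncated_fourier n v) \+ (W \- truncated_fourier n u).
  by apply/funext => t /=; rewrite opprD addrACA.
apply: L2normD; apply: cmeasurableB; by [case: LV|case: LW|
  exact: truncated_fourier_measurable].
Qed.

Lemma is_fourier_unique v V W : is_fourier v V -> is_fourier v W ->
  L2norm (V \- W) = 0%E.
Proof.
move=> [Lv [mV _] cV] [_ [mW _] cW].
have : (fun _ : nat => L2norm (V \- W)) @ \oo --> 0%E.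
  apply: squeeze_cvge0D cV cW ; [by move=> n; exact: L2norm_ge0|apply: nearW => n].
  rewrite [X in (_ + X)%E]L2norm_subC; apply: L2norm_triangle => //.
  exact: truncated_fourier_measurable.
by move/(cvg_unique (@ereal_hausdorff R) (cvg_cst _)).
Qed.

(** The transform may be replaced by any other representative of its class. This is used for the
    source, where [is_given_source] and the given solution provide different representatives. *)
Lemma is_fourier_ae v V W : is_fourier v V -> in_L2 W -> L2norm (V \- W) = 0%E ->
  is_fourier v W.
Proof.
move=> [Lv LV cV] LW VW; split => //.
have c0 : (fun _ : nat => L2norm (W \- V)) @ \oo --> 0%E.
  by rewrite L2norm_subC VW; exact: cvg_cst.
apply: squeeze_cvge0D c0 cV ; [by move=> n; exact: L2norm_ge0|apply: nearW => n].
apply: L2norm_triangle; by [case: LV|case: LW|exact: truncated_fourier_measurable].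
Qed.

End FourierL2.

(** * The integral equation *)

Section ComplexExponential.
Context {R : realType}.
Local Notation mu := (@lebesgue_measure R).
Local Notation Re := complex.Re.
Local Notation Im := complex.Im.
Implicit Types (B c : R[i]).

Lemma cexpD (z1 z2 : R[i]) : cexp (z1 + z2) = cexp z1 * cexp z2.
Proof.
case: z1 => a b; case: z2 => c d; apply/eqP.
by rewrite eq_complex /= expRD cosD sinD; apply/andP; split; apply/eqP; ring.
Qed.

Lemma cexp0 : cexp 0 = 1 :> R[i].
Proof. by rewrite /cexp /= expR0 cos0 sin0 mulr1 mulr0. Qed.

Lemma cexpNK (z : R[i]) : cexp z * cexp (- z) = 1.
Proof. by rewrite -cexpD subrr cexp0. Qed.

Lemma cexp_neq0 (z : R[i]) : cexp z != 0.
Proof.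
apply/eqP => z0; have := cexpNK z.
by rewrite z0 mul0r => /esym/eqP; rewrite oner_eq0.
Qed.

Lemma cexpN (z : R[i]) : cexp (- z) = (cexp z)^-1.
Proof. by apply: (mulfI (cexp_neq0 z)); rewrite cexpNK divff// cexp_neq0. Qed.

Lemma sqnorm_cexp (z : R[i]) : sqnorm (cexp z) = expR (2 * Re z).
Proof.
rewrite /sqnorm /cexp /= !exprMn -mulrDr cos2Dsin2 mulr1.
by rewrite expr2 -expRD -mulr2n mulr_natl.
Qed.

(** With c = a + i b and B = p + i q this is the real part of the identity that the integral of c B
    exp (c z) over [0, x] is B (exp (c x) - 1). Replacing (p, q) by (q, - p) gives the imaginary
    part. *)
Lemma integral_expR_trig (a b p q x : R) : 0 <= x ->
  (\int[mu]_(z in `[0%R, x]) (expR (a * z) *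
     ((a * p - b * q) * cos (b * z) - (a * q + b * p) * sin (b * z)))%:E =
  (expR (a * x) * (p * cos (b * x) - q * sin (b * x)) - p)%:E)%E.
Proof.
move=> x0.
pose F z := expR (a * z) * (p * cos (b * z) - q * sin (b * z)).
pose f z := expR (a * z) *
  ((a * p - b * q) * cos (b * z) - (a * q + b * p) * sin (b * z)).
have dF (z : R) : is_derive z (1 : R) F (f z).
  rewrite /F /f; apply: is_derive_eq.
  by rewrite /GRing.scale /= !mulr1; ring.
have cF : continuous F.
  by move=> z; apply: differentiable_continuous; apply/derivable1_diffP; exact: ex_derive.
have F0 : F 0 = p by rewrite /F !mulr0 expR0 cos0 sin0; ring.
move: x0; rewrite le_eqVlt => /predU1P[<-|x0].
  by rewrite set_itv1 integral_set1 -/(F 0) F0 subrr.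
rewrite (@continuous_FTC2 _ f F)// ?F0//.
- apply: continuous_subspaceT => z; apply: cvgM.
    by apply: continuous_comp; [apply: cvgMl_tmp; exact: cvg_id|exact: continuous_expR].
  by apply: cvgB; apply: cvgMl_tmp; [exact: continuous_cosM|exact: continuous_sinM].
- split.
  + by move=> z _; exact: ex_derive.
  + by apply: cvg_at_right_filter; exact: cF.
  + by apply: cvg_at_left_filter; exact: cF.
- by move=> z _; rewrite derive1E derive_val.
Qed.

Lemma integrable_expR_trig (a b p q x : R) : 0 <= x ->
  mu.-integrable `[0, x] (EFin \o (fun z => expR (a * z) *
     ((a * p - b * q) * cos (b * z) - (a * q + b * p) * sin (b * z)))).
Proof.
move=> x0; apply: continuous_compact_integrable; first exact: segment_compact.
apply: continuous_subspaceT => z; apply: cvgM.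
  by apply: continuous_comp; [apply: cvgMl_tmp; exact: cvg_id|exact: continuous_expR].
by apply: cvgB; apply: cvgMl_tmp; [exact: continuous_cosM|exact: continuous_sinM].
Qed.

Lemma cintegralD (i : interval R) (f g : R -> R[i]) :
  let D := [set` i] in cintegrable D f -> cintegrable D g ->
  cintegrable D (fun z => f z + g z) /\
  cintegral D (fun z => f z + g z) = cintegral D f + cintegral D g.
Proof.
move=> D [fr fi] [gr gi].
have ReE : (fun z => Re (f z + g z)) = (fun z => Re (f z) + Re (g z)).
  by apply/funext => z; case: (f z); case: (g z).
have ImE : (fun z => Im (f z + g z)) = (fun z => Im (f z) + Im (g z)).
  by apply/funext => z; case: (f z); case: (g z).
split.
  split.
    have := @integrableD _ _ _ mu D (measurable_itv i) _ _ fr gr; apply: eq_integrable.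
      exact: measurable_itv.
    by move=> z _ /=; case: (f z) => ? ?; case: (g z).
  have := @integrableD _ _ _ mu D (measurable_itv i) _ _ fi gi; apply: eq_integrable.
    exact: measurable_itv.
  by move=> z _ /=; case: (f z) => ? ?; case: (g z).
apply/eqP; rewrite eq_complex /=; apply/andP; split; apply/eqP.
  by rewrite -(@RintegralD _ _ _ mu D _ _ (measurable_itv i) fr gr); congr Rintegral; exact: ReE.
by rewrite -(@RintegralD _ _ _ mu D _ _ (measurable_itv i) fi gi); congr Rintegral; exact: ImE.
Qed.

(** Keeping the factor c in the integrand avoids a division, so c = 0 is included. Below, c is m - k
    or m + k. *)
Lemma cintegral_cexp c B (x : R) : 0 <= x ->
  cintegrable `[0, x] (fun z => c * B * cexp (c * z%:C)) /\
  cintegral `[0, x] (fun z => c * B * cexp (c * z%:C)) =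
    B * (cexp (c * x%:C) - 1).
Proof.
case: c => a b; case: B => p q x0.
have ReE (z : R) : Re ((a +i* b) * (p +i* q) * cexp ((a +i* b) * z%:C)) =
    expR (a * z) * ((a * p - b * q) * cos (b * z) - (a * q + b * p) * sin (b * z)).
  by rewrite /= !mulr0 subr0 add0r; ring.
have ImE (z : R) : Im ((a +i* b) * (p +i* q) * cexp ((a +i* b) * z%:C)) =
    expR (a * z) * ((a * q - b * (- p)) * cos (b * z) - (a * (- p) + b * q) * sin (b * z)).
  by rewrite /= !mulr0 subr0 add0r; ring.
split.
  split.
    have := integrable_expR_trig a b p q x0; apply: eq_integrable.
      exact: measurable_itv.
    by move=> z _; congr EFin; exact/esym/ReE.
  have := integrable_expR_trig a b q (- p) x0; apply: eq_integrable.
    exact: measurable_itv.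
  by move=> z _; congr EFin; exact/esym/ImE.
have -> : cintegral `[0, x] (fun z => (a +i* b) * (p +i* q) * cexp ((a +i* b) * z%:C)) =
    (expR (a * x) * (p * cos (b * x) - q * sin (b * x)) - p) +i*
    (expR (a * x) * (q * cos (b * x) - - p * sin (b * x)) - q).
  congr (_ +i* _).
    rewrite -[RHS]/(fine (_%:E)) -integral_expR_trig//; congr fine.
    by apply: eq_integral => z _; congr EFin; exact: ReE.
  rewrite -[RHS]/(fine (_%:E)) -integral_expR_trig//; congr fine.
  by apply: eq_integral => z _; congr EFin; exact: ImE.
apply/eqP; rewrite eq_complex /=.
by rewrite !mulr0 subr0 add0r; apply/andP; split; apply/eqP; ring.
Qed.

End ComplexExponential.

Section ExponentialSolution.
Context {R : realType}.
Implicit Types (k m s E : R[i]).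

(* With m^2 = k^2 - s the exponential cexp (m z) solves U'' = k^2 U - s U; this
   is the integrated form of that equation. *)
Lemma cexp_integral_equation k m s E (x : R) : 0 <= x -> k != 0 ->
  m * m = k * k - s ->
  let K z := csinh (k * (x - z)%:C) / k * (s * (cexp (m * z%:C) * E)) in
  cintegrable `[0, x] K /\
  cexp (m * x%:C) * E =
    ccosh (k * x%:C) * E + csinh (k * x%:C) / k * (m * E) - cintegral `[0, x] K.
Proof.
move=> x0 k0 mks K.
pose e := cexp (k * x%:C); pose e' := cexp (- (k * x%:C)).
(* The hyperbolic sine splits the integrand into exponentials of rates m - k and m + k. As s = (k -
   m) (k + m), each coefficient contains its own rate as a factor; [B1] and [B2] are the remaining
   cofactors. *)
pose B1 := - (m + k) * E * e * (k^-1 / 2).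
pose B2 := (m - k) * E * e' * (k^-1 / 2).
have KE : K = (fun z : R => (m - k) * B1 * cexp ((m - k) * z%:C) +
    (m + k) * B2 * cexp ((m + k) * z%:C)).
  apply/funext => z; rewrite /K /csinh.
  have -> : s = k * k - m * m by rewrite mks; ring.
  have -> : k * (x - z)%:C = k * x%:C + - (k * z%:C).
    by rewrite rmorphB /=; ring.
  rewrite opprD opprK !cexpD -/e -/e' mulrBl !mulrDl !cexpD.
  rewrite (_ : - (k * z%:C) = - k * z%:C); last by ring.
  rewrite mulNr; rewrite /B1 /B2.
  move: (cexp (m * z%:C)) (cexp (k * z%:C)) (cexp (- (k * z%:C))) => u v w.
  by ring.
have [i1 I1] := cintegral_cexp (m - k) B1 x0.
have [i2 I2] := cintegral_cexp (m + k) B2 x0.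
have [iK IK] := cintegralD i1 i2.
rewrite KE; split => //; rewrite IK I1 I2 /ccosh /csinh.
have -> : (m - k) * x%:C = m * x%:C + - (k * x%:C) by ring.
have -> : (m + k) * x%:C = m * x%:C + k * x%:C by ring.
rewrite !cexpD -/e -/e' /B1 /B2.
have -> : e' = e^-1 by rewrite /e' cexpN.
have e0 : e != 0 by exact: cexp_neq0.
move: (cexp (m * x%:C)) => u.
by field; rewrite e0 k0.
Qed.

End ExponentialSolution.

(** * Perturbations supported in a frequency band *)

Section FrequencyBand.
Context {R : realType}.
Local Notation mu := (@lebesgue_measure R).
Local Notation Re := complex.Re.
Local Notation Im := complex.Im.
Implicit Types (F G : R -> R[i]).

Definition ccontinuous F : Prop :=
  continuous (fun y => Re (F y)) /\ continuous (fun y => Im (F y)).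

Lemma ccontinuous_cst (c : R[i]) : ccontinuous (fun=> c).
Proof. by split=> y; exact: cvg_cst. Qed.

Lemma ccontinuousM F G : ccontinuous F -> ccontinuous G ->
  ccontinuous (fun y => F y * G y).
Proof.
move=> [Fr Fi] [Gr Gi]; split.
  rewrite (_ : (fun y => _) = (fun y => Re (F y) * Re (G y) - Im (F y) * Im (G y))).
    by move=> y; apply: cvgB; apply: cvgM; [exact: Fr|exact: Gr|exact: Fi|exact: Gi].
  by apply/funext => y; case: (F y) => ? ?; case: (G y).
rewrite (_ : (fun y => _) = (fun y => Re (F y) * Im (G y) + Im (F y) * Re (G y))).
  by move=> y; apply: cvgD; apply: cvgM; [exact: Fr|exact: Gi|exact: Fi|exact: Gr].
by apply/funext => y; case: (F y) => ? ?; case: (G y).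
Qed.

Lemma ccontinuousB F G : ccontinuous F -> ccontinuous G ->
  ccontinuous (fun y => F y - G y).
Proof.
move=> [Fr Fi] [Gr Gi]; split.
  rewrite (_ : (fun y => _) = (fun y => Re (F y) - Re (G y))).
    by move=> y; apply: cvgB; [exact: Fr|exact: Gr].
  by apply/funext => y; case: (F y) => ? ?; case: (G y).
rewrite (_ : (fun y => _) = (fun y => Im (F y) - Im (G y))).
  by move=> y; apply: cvgB; [exact: Fi|exact: Gi].
by apply/funext => y; case: (F y) => ? ?; case: (G y).
Qed.

Lemma ccontinuousN F : ccontinuous F -> ccontinuous (fun y => - F y).
Proof.
move=> cF; rewrite (_ : (fun y => _) = (fun y => 0 - F y)).
  by apply: ccontinuousB => //; exact: ccontinuous_cst.
by apply/funext => y; rewrite sub0r.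
Qed.

Lemma ccontinuous_cexp F : ccontinuous F -> ccontinuous (fun y => cexp (F y)).
Proof.
move=> [Fr Fi]; have ce : continuous (fun y => expR (Re (F y))).
  by move=> y; apply: continuous_comp; [exact: Fr|exact: continuous_expR].
split=> y; apply: cvgM; try exact: ce.
  by apply: continuous_comp; [exact: Fi|exact: continuous_cos].
by apply: continuous_comp; [exact: Fi|exact: continuous_sin].
Qed.

Lemma continuous_sqnorm F : ccontinuous F -> continuous (fun y => sqnorm (F y)).
Proof.
move=> [Fr Fi] y; apply: cvgD.
  apply: (@continuous_comp _ _ _ (fun y => Re (F y)) (fun x => x ^+ 2)).
    exact: Fr.
  exact: exprn_continuous.
apply: (@continuous_comp _ _ _ (fun y => Im (F y)) (fun x => x ^+ 2)).
  exact: Fi.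
exact: exprn_continuous.
Qed.

(** The half-angle formulas, with both coordinates nonnegative. The result is continuous on the
    whole plane, so continuity in the frequency variable carries no side condition. *)
Definition croot (z : R[i]) : R[i] :=
  Num.sqrt ((Num.sqrt (sqnorm z) + Re z) / 2) +i*
  Num.sqrt ((Num.sqrt (sqnorm z) - Re z) / 2).

Lemma normr_Re_le (z : R[i]) : `|Re z| <= Num.sqrt (sqnorm z).
Proof. by rewrite -sqrtr_sqr ler_sqrt ?sqnorm_ge0// lerDl sqr_ge0. Qed.

Lemma Re_croot_ge0 (z : R[i]) : 0 <= Re (croot z).
Proof. exact: sqrtr_ge0. Qed.

Lemma sqr_Re_croot (z : R[i]) :
  Re (croot z) ^+ 2 = (Num.sqrt (sqnorm z) + Re z) / 2.
Proof.
rewrite sqr_sqrtr// divr_ge0// -lerBlDr sub0r.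
by have := normr_Re_le z; rewrite ler_norml => /andP[+ _]; rewrite lerNl.
Qed.

Lemma sqr_Im_croot (z : R[i]) :
  Im (croot z) ^+ 2 = (Num.sqrt (sqnorm z) - Re z) / 2.
Proof.
rewrite sqr_sqrtr// divr_ge0// subr_ge0.
by have := normr_Re_le z; rewrite ler_norml => /andP[].
Qed.

Lemma sqnorm_croot (z : R[i]) : sqnorm (croot z) = Num.sqrt (sqnorm z).
Proof. by rewrite /sqnorm sqr_Re_croot sqr_Im_croot -/(sqnorm z); field. Qed.

Lemma Re_le_sqr_Re_croot (z : R[i]) : Re z <= Re (croot z) ^+ 2.
Proof.
rewrite sqr_Re_croot; have := normr_Re_le z; rewrite ler_norml => /andP[_].
by move: (Num.sqrt _) => r; lra.
Qed.

(* The two square roots are taken nonnegative, so only arguments in the closed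
   upper half-plane are recovered. *)
Lemma croot_sqr (z : R[i]) : 0 <= Im z -> croot z * croot z = z.
Proof.
move=> z0; have hr := sqr_Re_croot z; have hi := sqr_Im_croot z.
(* The product of the two radicands is (|z|^2 - (Re z)^2) / 4 = (Im z / 2)^2, and the sign of Im z
   selects its root. *)
have hri : Re (croot z) * Im (croot z) = Im z / 2.
  have /eqP := sqr_sqrtr (sqnorm_ge0 z).
  move=> /eqP hs; rewrite /= -sqrtrM; last first.
    by have := normr_Re_le z; rewrite ler_norml => /andP[h _];
      rewrite divr_ge0// -lerBlDr sub0r lerNl.
  rewrite [X in Num.sqrt X](_ : _ = (Im z / 2) ^+ 2); last first.
    move: hs; rewrite {2}/sqnorm; move: (Num.sqrt _) => s hs.
    rewrite [LHS](_ : _ = (s ^+ 2 - Re z ^+ 2) / 4); last by field.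
    by rewrite hs; field.
  by rewrite sqrtr_sqr ger0_norm// divr_ge0.
apply/eqP; rewrite eq_complex.
case E : (croot z) hr hi hri => [r i] /= hr hi hri.
apply/andP; split; apply/eqP.
  by rewrite -!expr2 hr hi; field.
by rewrite (mulrC i) hri; field.
Qed.

Lemma ccontinuous_croot F : ccontinuous F -> ccontinuous (fun y => croot (F y)).
Proof.
move=> cF; have [Fr Fi] := cF.
have cs : continuous (fun y => Num.sqrt (sqnorm (F y))).
  by move=> y; apply: continuous_comp; [exact: continuous_sqnorm|exact: sqrt_continuous].
split=> y; apply: continuous_comp; try exact: sqrt_continuous;
  apply: cvgMr_tmp.
  by apply: cvgD; [exact: cs|exact: Fr].
by apply: cvgB; [exact: cs|exact: Fr].
Qed.

Variables (p a : R).
Hypotheses (p0 : 0 < p) (a0 : 0 < a).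

(** For p = alpha / 2 this is the modulus of [ksymb alpha w]. All functions on the band are
    continuous functions of this one real variable. *)
Definition kappa (w : R) : R := `|w| `^ p.

Definition band F (w : R) : R[i] :=
  if w \in `[a, a + 1] then F (kappa w) else 0.

Lemma measurable_kappa : measurable_fun setT kappa.
Proof.
apply: (@measurableT_comp _ _ _ _ _ _ (@powR R ^~ p)).
  exact: measurable_powR.
exact: normr_measurable.
Qed.

Lemma continuous_kappa (w : R) : 0 < w -> {for w, continuous kappa}.
Proof.
move=> w0; apply: (@continuous_comp _ _ _ (fun w : R => `|w|) (@powR R ^~ p)).
  exact: norm_continuous.
apply: differentiable_continuous; apply/derivable1_diffP.
by apply: derivable_powR; rewrite in_itv/= andbT normr_gt0 gt_eqF.
Qed.

Lemma band_kappa (w : R) : w \in `[a, a + 1] ->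
  kappa a <= kappa w <= kappa (a + 1).
Proof.
rewrite in_itv/= => /andP[aw wa].
have w0 : 0 < w by exact: lt_le_trans aw.
have a10 : 0 < a + 1 by rewrite addr_gt0.
rewrite /kappa !gtr0_norm//; apply/andP; split;
  by apply: ge0_ler_powR; rewrite ?nnegrE ?(ltW p0) ?(ltW w0) ?(ltW a0) ?(ltW a10).
Qed.

Lemma band_bounded (F : R -> R) : continuous F ->
  exists2 M, 0 <= M & forall w, w \in `[a, a + 1] -> `|F (kappa w)| <= M.
Proof.
move=> cF.
have aa1 : a \in `[a, a + 1] by rewrite in_itv/= lexx lerDl ler01.
have [c _ Mc] := @EVT_max R (fun y => `|F y|) (kappa a) (kappa (a + 1))
  (le_trans (andP (band_kappa aa1)).1 (andP (band_kappa aa1)).2)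
  (continuous_subspaceT (fun y => continuous_comp (cF y) (@norm_continuous _ _ _))).
exists `|F c| => // w /band_kappa kw.
by apply: Mc; rewrite in_itv.
Qed.

Lemma band_truncated_continuous F : ccontinuous F ->
  ctruncated_continuous a (a + 1) (band F).
Proof.
move=> [Fr Fi]; split.
  rewrite (_ : (fun w => _) = (fun w => if w \in `[a, a + 1] then Re (F (kappa w)) else 0)).
    have [M _ FM] := band_bounded Fr.
    apply: truncated_continuous_if FM _.
      apply: (@measurableT_comp _ _ _ _ _ _ (fun y => Re (F y)) _ kappa); last first.
      exact: measurable_kappa.
      exact: continuous_measurable_fun.
    move=> w /andP[aw _]; apply: (@continuous_comp _ _ _ kappa (fun y => Re (F y))); last exact: Fr.
    by apply: continuous_kappa; apply: lt_trans aw.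
  by apply/funext => w; rewrite /band; case: ifP.
rewrite (_ : (fun w => _) = (fun w => if w \in `[a, a + 1] then Im (F (kappa w)) else 0)).
  have [M _ FM] := band_bounded Fi.
  apply: truncated_continuous_if FM _.
    apply: (@measurableT_comp _ _ _ _ _ _ (fun y => Im (F y)) _ kappa); last first.
      exact: measurable_kappa.
    exact: continuous_measurable_fun.
  move=> w /andP[aw _]; apply: (@continuous_comp _ _ _ kappa (fun y => Im (F y))); last exact: Fi.
  by apply: continuous_kappa; apply: lt_trans aw.
by apply/funext => w; rewrite /band; case: ifP.
Qed.

Lemma energy_band F : energy (band F) =
  (\int[mu]_(w in `[a, (a + 1)%R]) (sqnorm (F (kappa w)))%:E)%E.
Proof.
rewrite /energy [RHS]integral_mkcond; apply: eq_integral => w _.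
rewrite /patch /band mem_setE; case: ifP => //.
by rewrite /sqnorm /= expr0n addr0.
Qed.

Lemma integral_band_cst (C : R) :
  (\int[mu]_(w in `[a, (a + 1)%R]) C%:E = C%:E)%E.
Proof.
rewrite integral_cst//= lebesgue_measure_itv/= lte_fin ltrDl ltr01.
by rewrite -EFinD addrAC subrr add0r mule1.
Qed.

Lemma energy_band_le F (C : R) : ccontinuous F ->
  (forall y, kappa a <= y -> sqnorm (F y) <= C) ->
  (energy (band F) <= C%:E)%E.
Proof.
move=> cF FC; rewrite energy_band -[leRHS]integral_band_cst.
apply: ge0_le_integral => //.
- by move=> w _; rewrite lee_fin sqnorm_ge0.
- apply/measurable_EFinP; apply: measurable_funTS.
  apply: (@measurableT_comp _ _ _ _ _ _ (fun y => sqnorm (F y))).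
    by apply: continuous_measurable_fun; exact: continuous_sqnorm.
  exact: measurable_kappa.
- by move=> w /= /band_kappa /andP[aw _]; rewrite lee_fin FC.
Qed.

Lemma energy_band_cst (c : R[i]) : energy (band (fun=> c)) = (sqnorm c)%:E.
Proof. by rewrite energy_band integral_band_cst. Qed.

End FrequencyBand.

(** * Growth and decay along the values of the symbol at positive frequencies *)

Section Symbol.
Context {R : realType}.
Local Notation mu := (@lebesgue_measure R).
Local Notation Re := complex.Re.
Local Notation Im := complex.Im.
Variable alpha : R.
Hypothesis halpha : 0 < alpha < 1.

Let th : R := alpha * pi / 4.
Let ct : R := cos th.
Let st : R := sin th.
(** [c2] and [s2] are the cosine and sine of 2 th = alpha pi / 2, so k^2 = y^2 (c2 + i s2) when |k|
    = y. *)
Let c2 : R := ct ^+ 2 - st ^+ 2.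
Let s2 : R := 2 * ct * st.

Let th_bounds : 0 < th < pi / 4.
Proof.
have [a0 a1] := andP halpha; have pi0 := pi_gt0 R; rewrite /th; apply/andP; split.
  by rewrite !mulr_gt0.
by rewrite ltr_pM2r// gtr_pMl.
Qed.

Let ct_gt0 : 0 < ct.
Proof.
have [t0 t1] := andP th_bounds; have pi0 := pi_gt0 R.
by apply: cos_gt0_pihalf; apply/andP; split; lra.
Qed.

Let st_gt0 : 0 < st.
Proof.
have [t0 t1] := andP th_bounds; have pi0 := pi_gt0 R.
by apply: sin_gt0_pi; apply/andP; split; lra.
Qed.

Let c2_gt0 : 0 < c2.
Proof.
have [t0 t1] := andP th_bounds; have pi0 := pi_gt0 R.
have -> : c2 = cos (th + th) by rewrite cosD /c2 /ct /st; ring.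
by apply: cos_gt0_pihalf; apply/andP; split; lra.
Qed.

Let s2_gt0 : 0 < s2.
Proof. by rewrite !mulr_gt0. Qed.

Let c2s2_le1 : c2 <= 1 /\ s2 <= 1.
Proof.
have h : ct ^+ 2 + st ^+ 2 = 1 by exact: cos2Dsin2.
rewrite /c2 /s2; have := sqr_ge0 st; have := sqr_ge0 (ct - st); split; nra.
Qed.

Definition ray (y : R) : R[i] := (y * ct) +i* (y * st).

Definition damp (y : R) : R[i] := (2^-1)%:C * cexp (- ray y).

Definition growth_sqr (y : R) : R[i] := ray y * ray y - damp y.

(** The rate m of the overview as a function of y = |w|^(alpha/2). It is known to be a square root
    of [growth_sqr y] once y reaches [threshold]. *)
Definition growth (y : R) : R[i] := croot (growth_sqr y).

Lemma ksymbE (w : R) : 0 < w -> ksymb alpha w = ray (kappa (alpha / 2) w).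
Proof.
move=> w0; rewrite /ksymb /ray /kappa gtr0_sg// mul1r -/th -/ct -/st.
by apply/eqP; rewrite eq_complex /= !mul0r subr0 addr0 !eqxx.
Qed.

Lemma source_multiplierE (w : R) : 0 < w ->
  source_multiplier alpha w = damp (kappa (alpha / 2) w).
Proof.
move=> w0; rewrite /source_multiplier ltW// ksymbE// /damp.
by rewrite fmorphV rmorph_nat.
Qed.

Lemma ccontinuous_ray : ccontinuous ray.
Proof. by split=> y; apply: cvgMr_tmp; exact: cvg_id. Qed.

Lemma ccontinuous_damp : ccontinuous damp.
Proof.
apply: ccontinuousM; first exact: ccontinuous_cst.
by apply: ccontinuous_cexp; apply: ccontinuousN; exact: ccontinuous_ray.
Qed.

Lemma ccontinuous_growth : ccontinuous growth.
Proof.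
apply: ccontinuous_croot; apply: ccontinuousB; last exact: ccontinuous_damp.
by apply: ccontinuousM; exact: ccontinuous_ray.
Qed.

Lemma ray_neq0 y : 0 < y -> ray y != 0.
Proof.
by move=> y0; rewrite eq_complex /= negb_and mulf_neq0// gt_eqF.
Qed.

Lemma damp_bound y : 0 <= y -> `|Re (damp y)| <= 2^-1 /\ `|Im (damp y)| <= 2^-1.
Proof.
move=> y0.
have h : sqnorm (damp y) <= 2^-1 ^+ 2.
  rewrite /damp sqnormM sqnorm_real sqnorm_cexp ler_piMr ?sqr_ge0//.
  by rewrite -expR0 ler_expR /= mulrN oppr_le0 !mulr_ge0// ltW.
have h2 : 0 <= 2^-1 :> R by rewrite invr_ge0.
by split; rewrite -(ler_pXn2r (_ : 0 < 2)%N) ?nnegrE//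
   real_normK ?num_real//; apply: le_trans h; rewrite /sqnorm ?lerDl ?lerDr sqr_ge0.
Qed.

Lemma Re_growth_sqr y : Re (growth_sqr y) = y ^+ 2 * c2 - Re (damp y).
Proof.
by rewrite /growth_sqr /ray /c2; case: (damp y) => u v /=; ring.
Qed.

Lemma Im_growth_sqr y : Im (growth_sqr y) = y ^+ 2 * s2 - Im (damp y).
Proof.
by rewrite /growth_sqr /ray /s2; case: (damp y) => u v /=; ring.
Qed.

(** The three summands ensure y >= 1, y^2 c2 >= 2 and y^2 s2 >= 1. Since the coordinates of [damp y]
    are at most 1/2 in absolute value, Re (m^2) is then at least y^2 c2 / 2 and k^2 - s lies in the
    upper half-plane. *)
Definition threshold : R := 1 + 2 / c2 + s2^-1.

Lemma threshold_ge1 : 1 <= threshold.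
Proof. by rewrite /threshold -addrA lerDl addr_ge0 ?divr_ge0 ?invr_ge0 ?ltW. Qed.

Let threshold_c2 y : threshold <= y -> 2 <= y ^+ 2 * c2.
Proof.
move=> ty; have y1 := le_trans threshold_ge1 ty.
have : 2 / c2 <= y.
  by apply: le_trans ty; rewrite /threshold addrAC lerDr addr_ge0// invr_ge0 ltW.
rewrite ler_pdivrMr// => /le_trans; apply.
by rewrite ler_pM2r// expr2 ler_peMl// (le_trans ler01).
Qed.

Let threshold_s2 y : threshold <= y -> 1 <= y ^+ 2 * s2.
Proof.
move=> ty; have y1 := le_trans threshold_ge1 ty.
have : s2^-1 <= y.
  by apply: le_trans ty; rewrite /threshold lerDr addr_ge0// divr_ge0// ltW.
rewrite -[_^-1]mul1r ler_pdivrMr// => /le_trans; apply.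
by rewrite ler_pM2r// expr2 ler_peMl// (le_trans ler01).
Qed.

Lemma growth_mul y : threshold <= y ->
  growth y * growth y = ray y * ray y - damp y.
Proof.
move=> ty; have y0 : 0 <= y by rewrite (le_trans ler01)// (le_trans threshold_ge1).
rewrite croot_sqr// Im_growth_sqr.
have [_] := damp_bound y0; rewrite ler_norml => /andP[_ h].
have := threshold_s2 ty; lra.
Qed.

(** |m|^2 is the modulus of [growth_sqr y], at most the sum of the absolute values of its
    coordinates. Each is at most y^2 + 1/2, and y >= 1 absorbs the constants. *)
Lemma sqnorm_growth y : threshold <= y -> sqnorm (growth y) <= 3 * y ^+ 2.
Proof.
move=> ty; have y1 := le_trans threshold_ge1 ty.
have y0 : 0 <= y by rewrite (le_trans ler01).
rewrite sqnorm_croot.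
apply: (@le_trans _ _ (`|Re (growth_sqr y)| + `|Im (growth_sqr y)|)).
  rewrite -[leRHS]ger0_norm ?addr_ge0// -sqrtr_sqr ler_sqrt ?sqr_ge0//.
  rewrite sqrrD !real_normK ?num_real// /sqnorm addrAC lerDl.
  by rewrite mulrn_wge0// mulr_ge0.
have [hr hi] := damp_bound y0; have [c21 s21] := c2s2_le1.
have y21 : 1 <= y ^+ 2 by rewrite expr_ge1.
rewrite Re_growth_sqr Im_growth_sqr.
apply: (@le_trans _ _ ((y ^+ 2 + 2^-1) + (y ^+ 2 + 2^-1))); last by lra.
have h c d : 0 < c -> c <= 1 -> `|d| <= 2^-1 -> `|y ^+ 2 * c - d| <= y ^+ 2 + 2^-1.
  move=> c0 c1 d2; rewrite (le_trans (ler_normB _ _))// lerD//.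
  by rewrite ger0_norm ?mulr_ge0 ?sqr_ge0 ?(ltW c0)// ler_piMr ?sqr_ge0.
by apply: lerD; apply: h.
Qed.

(** The lower bound y^4 c2^2 / 64 for exp (2 Re m) divides 3 y^2, and 3 * 64 = 192. *)
Definition decay_cst : R := 192 / c2 ^+ 2.

Lemma decay_cst_ge0 : 0 <= decay_cst.
Proof. by apply: divr_ge0; [exact: ler0n|exact: sqr_ge0]. Qed.

(* exp (2 r) >= (r / 2)^4 with r = Re (growth y) >= y sqrt (c2 / 2). *)
Lemma sqnorm_cexp_growth y : threshold <= y ->
  sqnorm (cexp (- growth y)) * (3 * y ^+ 2) <= decay_cst / y ^+ 2.
Proof.
move=> ty; have y1 := le_trans threshold_ge1 ty.
have y0 : 0 < y by rewrite (lt_le_trans ltr01).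
rewrite sqnorm_cexp; set r := Re (growth y).
have r0 : 0 <= r by exact: Re_croot_ge0.
have -> : Re (- growth y) = - r by rewrite raddfN.
have rq : y ^+ 2 * c2 / 2 <= r ^+ 2.
  apply: le_trans (Re_le_sqr_Re_croot _); rewrite Re_growth_sqr.
  have [+ _] := damp_bound (ltW y0); rewrite ler_norml => /andP[_ h].
  by have := threshold_c2 ty; lra.
have h4 : (r / 2) ^+ 4 <= expR (2 * r).
  have -> : 2 * r = 4%:R * (r / 2) by field.
  rewrite expRM_natl lerXn2r ?nnegrE ?expR_ge0 ?divr_ge0//.
  by apply: le_trans (expR_ge1Dx _); rewrite lerDr.
have h5 : (y ^+ 2 * c2 / 2) ^+ 2 / 16 <= expR (2 * r).
  apply: le_trans h4; rewrite [leRHS](_ : _ = (r ^+ 2) ^+ 2 / 16); last by field.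
  by rewrite ler_pM2r// lerXn2r ?nnegrE ?sqr_ge0// divr_ge0// mulr_ge0 ?sqr_ge0 ?ltW.
have c20 := c2_gt0.
have y20 : 0 < y ^+ 2 by rewrite exprn_gt0.
have h6 : 0 < (y ^+ 2 * c2 / 2) ^+ 2 / 16.
  by rewrite divr_gt0// exprn_gt0// divr_gt0// mulr_gt0.
rewrite mulrN expRN.
apply: (@le_trans _ _ (((y ^+ 2 * c2 / 2) ^+ 2 / 16)^-1 * (3 * y ^+ 2))).
  by rewrite ler_pM2r ?mulr_gt0// lef_pV2 ?posrE ?expR_gt0.
rewrite le_eqVlt; apply/orP; left; apply/eqP; rewrite /decay_cst.
have := c2_gt0; move: c2 => c c0.
by field; rewrite !gt_eqF.
Qed.

(** The factor 3 y^2 of the preceding estimate exceeds both 1 and |m|^2, so one bound serves both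
    data. *)
Lemma sqnorm_growth_data y : threshold <= y ->
  sqnorm (cexp (- growth y)) <= decay_cst / y ^+ 2 /\
  sqnorm (growth y * cexp (- growth y)) <= decay_cst / y ^+ 2.
Proof.
move=> ty; have y1 := le_trans threshold_ge1 ty.
have y0 : 0 <= y by rewrite (le_trans ler01).
have y21 : 1 <= y ^+ 2 by rewrite expr_ge1.
have h := sqnorm_cexp_growth ty; split; apply: le_trans h.
  by rewrite ler_peMr ?sqnorm_ge0//; lra.
by rewrite sqnormM mulrC ler_wpM2l ?sqnorm_ge0// sqnorm_growth.
Qed.

End Symbol.

(** * The perturbed solution of the integral equation *)

Section Perturbation.
Context {R : realType}.
Local Notation mu := (@lebesgue_measure R).
Local Notation Re := complex.Re.
Local Notation Im := complex.Im.
Variables (alpha a : R).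
Hypotheses (halpha : 0 < alpha < 1) (a0 : 0 < a).
Hypothesis ta : threshold alpha <= kappa (alpha / 2) a.

Let p := alpha / 2.
Let m := growth alpha.

Let p0 : 0 < p.
Proof. by rewrite /p divr_gt0//; case/andP: halpha. Qed.

(** [pert_g] and [pert_h] are the value and the x-derivative at x = 0 of the growing exponential
    [pert_profile]. *)
Definition pert_g : R -> R[i] := band p a (fun y => cexp (- m y)).

Definition pert_h : R -> R[i] := band p a (fun y => m y * cexp (- m y)).

(** Kept as a product, rather than as one exponential of m (x - 1), to match
    [cexp_integral_equation] with E = exp (- m). *)
Definition pert_profile (x y : R) : R[i] := cexp (m y * x%:C) * cexp (- m y).

Definition pert_u (x : R) : R -> R[i] := band p a (pert_profile x).

Definition pert_f (x : R) : R -> R[i] :=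
  band p a (fun y => damp alpha y * pert_profile x y).

Lemma ccontinuous_pert_profile x : ccontinuous (pert_profile x).
Proof.
have cm := ccontinuous_growth alpha.
apply: ccontinuousM; apply: ccontinuous_cexp; last exact: ccontinuousN.
by apply: ccontinuousM => //; exact: ccontinuous_cst.
Qed.

Lemma pert_g_truncated : ctruncated_continuous a (a + 1) pert_g.
Proof.
apply: band_truncated_continuous => //; apply: ccontinuous_cexp.
by apply: ccontinuousN; exact: ccontinuous_growth.
Qed.

Lemma pert_h_truncated : ctruncated_continuous a (a + 1) pert_h.
Proof.
apply: band_truncated_continuous => //; have cm := ccontinuous_growth alpha.
by apply: ccontinuousM => //; apply: ccontinuous_cexp; exact: ccontinuousN.
Qed.

Lemma pert_u_truncated x : ctruncated_continuous a (a + 1) (pert_u x).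
Proof. by apply: band_truncated_continuous => //; exact: ccontinuous_pert_profile. Qed.

Lemma pert_f_truncated x : ctruncated_continuous a (a + 1) (pert_f x).
Proof.
apply: band_truncated_continuous => //.
by apply: ccontinuousM; [exact: ccontinuous_damp|exact: ccontinuous_pert_profile].
Qed.

Lemma pert_fE z w : pert_f z w = source_multiplier alpha w * pert_u z w.
Proof.
rewrite /pert_f /pert_u /band; case: ifPn => [|_]; last by rewrite mulr0.
rewrite in_itv/= => /andP[aw _].
by rewrite source_multiplierE//; apply: lt_le_trans aw.
Qed.

(** Valid at every frequency: off the band all terms vanish, and on it y is past [threshold], so m^2
    = k^2 - s and the exponential identity applies. *)
Lemma pert_equation (x w : R) : 0 <= x ->
  cintegrable `[0, x] (fun z => sinh_over_k alpha w (x - z) * pert_f z w) /\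
  pert_u x w = ccosh (ksymb alpha w * x%:C) * pert_g w +
    sinh_over_k alpha w x * pert_h w -
    cintegral `[0, x] (fun z => sinh_over_k alpha w (x - z) * pert_f z w).
Proof.
move=> x0; rewrite /pert_u /pert_g /pert_h.
have [wb|wb] := boolP (w \in `[a, a + 1]); last first.
  rewrite /band (negbTE wb) !mulr0 addr0 sub0r.
  rewrite (_ : (fun z => _) = (fun=> 0)); last first.
    by apply/funext => z; rewrite /pert_f /band (negbTE wb) mulr0.
  rewrite /cintegral /cintegrable /= /Rintegral integral0/= oppr0.
  by split => //; split; exact: integrable0.
have aw : a <= w by move: wb; rewrite in_itv/= => /andP[].
have w0 : 0 < w by exact: lt_le_trans aw.
have tw : threshold alpha <= kappa p w.
  by apply: le_trans ta _; have /andP[] := band_kappa p0 a0 wb.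
have k0 : 0 < kappa p w.
  by rewrite (lt_le_trans ltr01)// (le_trans (threshold_ge1 halpha)).
have [] := @cexp_integral_equation R (ray alpha (kappa p w)) (m (kappa p w))
  (damp alpha (kappa p w)) (cexp (- m (kappa p w))) x x0
  (ray_neq0 halpha k0) (growth_mul halpha tw).
by rewrite /pert_f /pert_profile /band wb /sinh_over_k gt_eqF// ksymbE.
Qed.

Lemma measurable_pert_f :
  cmeasurable_fun setT (fun q : R * R => pert_f q.1 q.2).
Proof.
pose I (q : R * R) : R[i] := (\1_(`[a, a + 1]%classic) q.2)%:C.
have mI : cmeasurable_fun setT I.
  split=> /=; last exact: measurable_cst.
  apply: (@measurableT_comp _ _ _ _ _ _ (\1_(`[a, a + 1]%classic) : R -> R) _ snd).
    exact: measurable_indic.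
  exact: measurable_snd.
have mF (F : R -> R[i]) : ccontinuous F ->
    cmeasurable_fun setT (fun q : R * R => F (kappa p q.2)).
  have mk : measurable_fun setT (fun q : R * R => kappa p q.2).
    exact: (measurableT_comp (measurable_kappa p) measurable_snd).
  move=> [Fr Fi]; split.
    apply: (@measurableT_comp _ _ _ _ _ _ (fun y => Re (F y)) _ _ _ mk).
    exact: continuous_measurable_fun.
  apply: (@measurableT_comp _ _ _ _ _ _ (fun y => Im (F y)) _ _ _ mk).
  exact: continuous_measurable_fun.
have mX : cmeasurable_fun setT (fun q : R * R => (q.1)%:C).
  by split=> /=; [exact: measurable_fst|exact: measurable_cst].
have mcexp (F : R * R -> R[i]) : cmeasurable_fun setT F ->
    cmeasurable_fun setT (fun q => cexp (F q)).
  move=> [Fr Fi].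
  have me : measurable_fun setT (fun q => expR (Re (F q))).
    exact: measurableT_comp Fr.
  split; apply: measurable_funM => //.
    apply: (@measurableT_comp _ _ _ _ _ _ (@cos R)) Fi.
    by apply: continuous_measurable_fun; exact: continuous_cos.
  apply: (@measurableT_comp _ _ _ _ _ _ (@sin R)) Fi.
  by apply: continuous_measurable_fun; exact: continuous_sin.
have cm := ccontinuous_growth alpha.
rewrite (_ : (fun q => _) = I \* ((fun q => damp alpha (kappa p q.2)) \*
  ((fun q => cexp (m (kappa p q.2) * (q.1)%:C)) \*
   (fun q => cexp (- m (kappa p q.2)))))).
  apply: cmeasurableM => //; apply: cmeasurableM.
    exact: mF (ccontinuous_damp alpha).
  apply: cmeasurableM.
    by apply: mcexp; apply: cmeasurableM => //; exact: mF.
  by apply: (mF (fun y => cexp (- m y))); apply: ccontinuous_cexp; exact: ccontinuousN.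
apply/funext => q; rewrite /I /pert_f /band /= indicE mem_setE.
by case: (q.2 \in _); rewrite ?mul1r ?mul0r.
Qed.

(** Dominated convergence over the band: at each frequency the profile is continuous in x, and on
    the bounded band Re m, hence the profile for nearby x, is bounded. *)
Lemma pert_u_continuous (x : R) : x \in `[0, 1] ->
  L2norm (pert_u y \- pert_u x) @[y --> x] --> 0%E.
Proof.
move=> x01; apply: L2norm_cvg0.
pose D (y e : R) := pert_profile y e - pert_profile x e.
have cD y : ccontinuous (D y).
  by apply: ccontinuousB; exact: ccontinuous_pert_profile.
have DE y : pert_u y \- pert_u x = band p a (D y).
  apply/funext => w; rewrite /pert_u /band /=.
  by case: ifP => _ //; rewrite subr0.
under eq_fun do rewrite DE energy_band.
pose B : set R := `[a, a + 1]%classic.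
pose f (y w : R) := sqnorm (D y (kappa p w)).
have cRe : continuous (fun y => Re (m y)) by case: (ccontinuous_growth alpha).
have [M M0 mM] := band_bounded p0 a0 cRe.
pose C := 4 * expR (4 * M).
have fC (y w : R) : y \in `](x - 1), (x + 1)[ -> B w -> `|f y w| <= C.
  rewrite in_itv/= => /andP[y1 y2] Bw.
  move: x01; rewrite in_itv/= => /andP[x0 x1].
  rewrite /f ger0_norm ?sqnorm_ge0// /D sqnormB.
  have rM := le_trans (ler_norm _) (mM _ Bw); have r0 := Re_croot_ge0
    (growth_sqr alpha (kappa p w)).
  have bound t : t <= 2 -> sqnorm (pert_profile t (kappa p w)) <= expR (4 * M).
    move=> t2; rewrite /pert_profile sqnormM !sqnorm_cexp -expRD ler_expR.
    have -> : Re (m (kappa p w) * t%:C) = Re (m (kappa p w)) * t.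
      by case: (m _) => u v /=; ring.
    have -> : Re (- m (kappa p w)) = - Re (m (kappa p w)) by case: (m _).
    rewrite -[croot _]/(m (kappa p w)) in r0.
    by move: rM r0; move: (Re _) => r rM r0; nra.
  have hy := bound y ltac:(lra); have hx := bound x ltac:(lra).
  move: hy hx; rewrite /sqnorm /C.
  move: (pert_profile y _) (pert_profile x _) => [y_r y_i] [x_r x_i] /=.
  move: (expR _) => e hy hx.
  by have := sqr_ge0 (y_r + x_r); have := sqr_ge0 (y_i + x_i); nra.
have mB : measurable B by exact: measurable_itv.
have muB : (mu B < +oo)%E.
  by rewrite /B /= lebesgue_measure_itv/=; case: ifP => _; rewrite ?ltry// -EFinD ltry.
have mf y : measurable_fun B (f y).
  apply: measurable_funTS.
  apply: (@measurableT_comp _ _ _ _ _ _ (fun e => sqnorm (D y e)) _ (kappa p)).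
    by apply: continuous_measurable_fun; exact: continuous_sqnorm.
  exact: measurable_kappa.
have if_ y : y \in `](x - 1), (x + 1)[ -> mu.-integrable B (EFin \o f y).
  move=> yx; apply: measurable_bounded_integrable => //; first exact: mf.
  exact: (ex_intro _ C (conj (num_real C)
    (fun r Cr w Bw => le_trans (fC y w yx Bw) (ltW Cr)))).
have iC : mu.-integrable B (EFin \o (fun=> C)).
  apply: measurable_bounded_integrable => //.
  exact: (ex_intro _ `|C| (conj (num_real `|C|) (fun r Cr w Bw => ltW Cr))).
have xx : x \in (`](x - 1), (x + 1)[%classic : set R).
  by rewrite inE /= in_itv/= ltrBlDr ltrDl ltr01.
have f0 : \int[mu]_(w in B) f x w = 0.
  rewrite (_ : f x = fun=> 0); first by rewrite /Rintegral integral0.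
  by apply/funext => w; rewrite /f /D subrr /sqnorm /= expr0n addr0.
have cvgf : \int[mu]_(w in B) f y w @[y --> x] --> 0.
  rewrite -f0; apply: (@continuity_under_integral R _ _ mu f B mB (x - 1) (x + 1)
    (fun y yx => if_ y yx) _ (fun=> C) iC _ x xx).
  - apply: aeW => w _ y _.
    apply: (@continuous_sqnorm _ (fun y => D y (kappa p w))).
    apply: ccontinuousB; last exact: ccontinuous_cst.
    apply: ccontinuousM; last exact: ccontinuous_cst.
    apply: ccontinuous_cexp; apply: ccontinuousM; first exact: ccontinuous_cst.
    by split=> z /=; [exact: cvg_id|exact: cvg_cst].
  - by move=> y yx; apply: aeW => w Bw; exact: fC.
apply/fine_cvgP; split; last exact: cvgf.
have xx' : x \in `](x - 1), (x + 1)[ by move: xx; rewrite inE.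
near=> y; have yx : y \in `](x - 1), (x + 1)[ by near: y; exact: near_in_itvoo.
exact: (@integrable_fin_num _ _ _ mu B _ (EFin \o f y) (if_ y yx)).
Unshelve. all: by end_near. Qed.

(** Every clause of [solution] is additive once the source acts as a multiplier. The delicate clause
    is the source transform, whose representative must remain jointly measurable. *)
Lemma solution_perturbation (f : R -> (R -> R[i]) -> R -> R[i])
    (g h : R -> R[i]) (u : R -> R -> R[i]) :
  is_given_source alpha f -> solution alpha f g h u ->
  solution alpha f (g \+ inv_fourier pert_g) (h \+ inv_fourier pert_h)
    (fun x => u x \+ inv_fourier (pert_u x)).
Proof.
move=> hf [[Lu cu] [gh [hh [U [F [gF hF uF mF eqU]]]]]].
have fgp := is_fourier_inv_fourier pert_g_truncated.
have fhp := is_fourier_inv_fourier pert_h_truncated.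
have fup x := is_fourier_inv_fourier (pert_u_truncated x).
split.
  split=> x x01; first by apply: in_L2D; [exact: Lu|case: (fup x)].
  have cp : L2norm (inv_fourier (pert_u y) \- inv_fourier (pert_u x))
      @[y --> within `[0, 1]%classic (nbhs x)] --> 0%E.
    (* The difference of two profiles is again a band function, so Plancherel transfers continuity
       in x from the frequencies to functions of t. *)
    have E y : L2norm (inv_fourier (pert_u y) \- inv_fourier (pert_u x)) =
        L2norm (pert_u y \- pert_u x).
      have [iX iY] := ctruncated_continuous_integrable (pert_u_truncated y).
      have [iP iQ] := ctruncated_continuous_integrable (pert_u_truncated x).
      rewrite -inv_fourierB//; apply: (@L2norm_inv_fourier _ a (a + 1)).
      rewrite (_ : _ \- _ = band p a (fun e => pert_profile y e - pert_profile x e)).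
        apply: band_truncated_continuous => //.
        by apply: ccontinuousB; exact: ccontinuous_pert_profile.
      apply/funext => w; rewrite /pert_u /band /=.
      by case: ifP => _ //; rewrite subr0.
    under eq_fun do rewrite E.
    apply: cvg_within_filter; exact: pert_u_continuous.
  apply: squeeze_cvge0D (cu x x01) cp.
    by move=> y; exact: L2norm_ge0.
  apply: filterS (withinT _ (nbhs_filter x)) => y y01.
  have -> : (u y \+ inv_fourier (pert_u y)) \- (u x \+ inv_fourier (pert_u x)) =
      (u y \- u x) \+ (inv_fourier (pert_u y) \- inv_fourier (pert_u x)).
    by apply/funext => t /=; rewrite opprD addrACA.
  have mu_ z : z \in `[0, 1] -> cmeasurable_fun setT (u z) by case/Lu.
  have mp z : cmeasurable_fun setT (inv_fourier (pert_u z)).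
    by case: (fup z) => -[].
  apply: L2normD; apply: cmeasurableB => //; exact: mu_.
exists (gh \+ pert_g), (hh \+ pert_h), (fun x => U x \+ pert_u x),
  (fun x => F x \+ pert_f x); split.
- exact: is_fourierD.
- exact: is_fourierD.
- move=> z z01; have [uU fF] := uF z z01.
  have uU' := is_fourierD uU (fup z); split; first exact: uU'.
  (* The multiplier yields the transform s (U z + pert_u z), but the jointly measurable candidate is
     F z + pert_f z. They differ by s (U z) - F z, of norm zero because both terms are transforms of
     f z (u z). *)
  apply: (is_fourier_ae (hf _ _ _ z01 uU')).
    apply: in_L2D; first by case: fF.
    by have [] := inv_fourier_in_L2 (pert_f_truncated z).
  rewrite -[RHS](is_fourier_unique (hf _ _ _ z01 uU) fF); congr L2norm.
  apply/funext => w /=; rewrite pert_fE mulrDr opprD addrACA subrr addr0.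
  by [].
- have [pr pi_] := measurable_pert_f.
  have mp : cmeasurable_fun (`[(0 : R), 1]%classic `*` [set: R])
      (fun q : R * R => pert_f q.1 q.2).
    by split; exact: measurable_funTS.
  exact: cmeasurableD mF mp.
- move=> x x01; have x0 : 0 <= x by move: x01; rewrite in_itv/= => /andP[].
  (* The perturbation satisfies its equation everywhere, so the exceptional null set of the given
     solution serves again. *)
  have [N [mN N0 UN]] := eqU x x01; exists N; split => //.
  apply: subset_trans UN; apply: subsetC => w [iF UE].
  have [ip pE] := pert_equation w x0.
  have [iFp IFp] := cintegralD iF ip.
  have E : (fun z => sinh_over_k alpha w (x - z) * (F z \+ pert_f z) w) =
      (fun z => sinh_over_k alpha w (x - z) * F z w +
        sinh_over_k alpha w (x - z) * pert_f z w).
    by apply/funext => z; rewrite /= mulrDr.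
  rewrite /mkset E; split; first exact: iFp.
  rewrite IFp -[LHS]/(U x w + pert_u x w) UE pE.
  rewrite -[(gh \+ pert_g) w]/(gh w + pert_g w) -[(hh \+ pert_h) w]/(hh w + pert_h w).
  move: (cintegral _ _) (cintegral _ _) (ccosh _) (sinh_over_k _ _ _) => I J C S.
  move: (gh w) (hh w) (pert_g w) (pert_h w) => A B A' B'.
  by ring.
Qed.

End Perturbation.

(** * Small data, and unit size at x = 1 *)

Section DataConvergence.
Context {R : realType}.
Variables (alpha a : R).
Hypotheses (halpha : 0 < alpha < 1) (a0 : 0 < a).
Hypothesis ta : threshold alpha <= kappa (alpha / 2) a.

Let p0 : 0 < alpha / 2.
Proof. by rewrite divr_gt0//; case/andP: halpha. Qed.

Let decay_le y : kappa (alpha / 2) a <= y ->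
  decay_cst alpha / y ^+ 2 <= decay_cst alpha / kappa (alpha / 2) a ^+ 2.
Proof.
move=> ay; have k0 : 0 < kappa (alpha / 2) a.
  by apply: lt_le_trans ta; apply: lt_le_trans (threshold_ge1 halpha).
have y0 : 0 < y by exact: lt_le_trans ay.
apply: ler_wpM2l; first exact: decay_cst_ge0.
by rewrite lef_pV2 ?posrE ?exprn_gt0// lerXn2r ?nnegrE ?(ltW k0) ?(ltW y0).
Qed.

Lemma energy_pert_g :
  (energy (pert_g alpha a) <= (decay_cst alpha / kappa (alpha / 2) a ^+ 2)%:E)%E.
Proof.
apply: energy_band_le => //.
  by apply: ccontinuous_cexp; apply: ccontinuousN; exact: ccontinuous_growth.
move=> y ay; apply: le_trans (decay_le ay).
by have [] := sqnorm_growth_data halpha (le_trans ta ay).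
Qed.

Lemma energy_pert_h :
  (energy (pert_h alpha a) <= (decay_cst alpha / kappa (alpha / 2) a ^+ 2)%:E)%E.
Proof.
apply: energy_band_le => //.
  apply: ccontinuousM; first exact: ccontinuous_growth.
  by apply: ccontinuous_cexp; apply: ccontinuousN; exact: ccontinuous_growth.
move=> y ay; apply: le_trans (decay_le ay).
by have [] := sqnorm_growth_data halpha (le_trans ta ay).
Qed.

(** At x = 1 the two exponentials of the profile cancel, leaving the indicator of an interval of
    length 1. *)
Lemma L2norm_pert_u1 : L2norm (pert_u alpha a 1) = 1%E.
Proof.
rewrite L2normE (_ : pert_u alpha a 1 = band (alpha / 2) a (fun=> 1)).
  rewrite energy_band_cst (_ : sqnorm 1 = 1) ?poweR1r//.
  by rewrite /sqnorm /= expr1n expr0n addr0.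
apply/funext => w; rewrite /pert_u /band; case: ifP => // _.
by rewrite /pert_profile mulr1 cexpNK.
Qed.

End DataConvergence.

Unset Implicit Arguments.

Theorem lemma2p4 (R : realType) (alpha : R) (halpha : 0 < alpha < 1)
    (f : R -> (R -> R[i]) -> (R -> R[i]))
    (hf : is_given_source alpha f)
    (g h : R -> R[i]) (u : R -> R -> R[i])
    (hg : in_L2 g) (hh : in_L2 h) (hu : solution alpha f g h u) :
  exists (gn hn : nat -> R -> R[i]) (un : nat -> R -> R -> R[i]),
    [/\ forall n, in_L2 (gn n) /\ in_L2 (hn n),
        forall n, solution alpha f (gn n) (hn n) (un n),
        (L2norm (gn n \- g)%R + L2norm (hn n \- h)%R)%E @[n --> \oo] --> 0%E &
        ~ (ereal_sup [set L2norm (un n x \- u x) | x in `[0, 1]%classic]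
             @[n --> \oo] --> 0%E)].
Proof.
have [al0 al1] := andP halpha.
have t1 := threshold_ge1 halpha.
pose N := Num.bound (threshold alpha).
have tN : threshold alpha <= N%:R.
  by apply/ltW/archi_boundP; rewrite (le_trans ler01).
(* The exponent 2 / alpha inverts [kappa], so the band starts at kappa = n + N, and the shift by N
   puts every band past [threshold]. *)
pose a (n : nat) : R := (n + N)%:R `^ (2 / alpha).
have N0 n : 1 <= (n + N)%:R :> R.
  by rewrite natrD (le_trans t1)// (le_trans tN)// lerDr.
have a0 n : 0 < a n by rewrite powR_gt0// (lt_le_trans ltr01).
have kE n : kappa (alpha / 2) (a n) = (n + N)%:R.
  rewrite /kappa gtr0_norm// /a -powRrM (_ : 2 / alpha * (alpha / 2) = 1).
    by rewrite powRr1// (le_trans ler01).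
  by field; rewrite gt_eqF.
have ta n : threshold alpha <= kappa (alpha / 2) (a n).
  by rewrite kE natrD (le_trans tN)// lerDr.
have tg n := pert_g_truncated halpha (a0 n).
have th n := pert_h_truncated halpha (a0 n).
have tu n x := pert_u_truncated halpha (a0 n) x.
exists (fun n => g \+ inv_fourier (pert_g alpha (a n))),
  (fun n => h \+ inv_fourier (pert_h alpha (a n))),
  (fun n x => u x \+ inv_fourier (pert_u alpha (a n) x)); split.
- move=> n; split; apply: in_L2D => //.
    by have [] := inv_fourier_in_L2 (tg n).
  by have [] := inv_fourier_in_L2 (th n).
- by move=> n; exact: solution_perturbation.
- have subE (v V : R -> R[i]) : (v \+ V) \- v = V.
    by apply/funext => t /=; rewrite addrC addKr.
  have cvg0 (V : nat -> R -> R[i]) :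
      (forall n, ctruncated_continuous (a n) (a n + 1) (V n)) ->
      (forall n, energy (V n) <=
        (decay_cst alpha / kappa (alpha / 2) (a n) ^+ 2)%:E)%E ->
      L2norm (inv_fourier (V n)) @[n --> \oo] --> 0%E.
    move=> tV eV; under eq_fun do rewrite (L2norm_inv_fourier (tV _)).
    apply: L2norm_cvg0.
    apply: (@squeeze_cvge _ _ _ _ (cst 0%E) _
      (fun n => (decay_cst alpha * n.+1%:R^-1)%:E)).
    + apply: nearW => n; rewrite energy_ge0 (le_trans (eV n))// lee_fin kE.
      apply: ler_wpM2l; first exact: decay_cst_ge0.
      (* N >= 1 because [threshold] is at least 1. With (n + N)^2 >= n + N, the bound becomes a
         multiple of the harmonic sequence. *)
      have nN : n.+1%:R <= (n + N)%:R :> R.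
        by rewrite ler_nat -addn1 leq_add2l -(ler_nat R) (le_trans t1).
      have nN0 : 0 < (n + N)%:R :> R by rewrite (lt_le_trans ltr01).
      rewrite lef_pV2 ?posrE ?exprn_gt0// (le_trans nN)//.
      by rewrite expr2 ler_peMr// ltW.
    + exact: cvg_cst.
    + apply: cvg_EFin; first exact: nearW.
      rewrite -[X in _ --> X](mulr0 (decay_cst alpha)); apply: cvgMl_tmp.
      exact: cvg_harmonic.
  have cgh : (L2norm (inv_fourier (pert_g alpha (a n))) +
      L2norm (inv_fourier (pert_h alpha (a n))))%E @[n --> \oo] --> 0%E.
    rewrite -[X in _ --> X]add0e; apply: cvgeD => //.
      by apply: cvg0 => // n; exact: energy_pert_g.
    by apply: cvg0 => // n; exact: energy_pert_h.
  by apply: cvg_trans cgh; apply: near_eq_cvg; apply: nearW => n; rewrite !subE.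
- set s := (fun n : nat => _) => s0.
  (* Each supremum is bounded below by its value at x = 1, where the perturbation has norm exactly
     1. *)
  have : (1 <= limn s)%E.
    apply: lime_ge; first by apply/cvg_ex; exists 0%E.
    apply: nearW => n; rewrite -(L2norm_pert_u1 alpha (a n)).
    rewrite -(L2norm_inv_fourier (tu n 1)); apply: ereal_sup_ubound.
    exists 1; first by rewrite /= in_itv/= ler01 lexx.
    by congr L2norm; apply/funext => t /=; rewrite addrC addKr.
  by rewrite (cvg_lim _ s0)// lee_fin ler10.
Qed.
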